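(* Let $K$ be an algebraically closed field with a nonarchimedean valuation $\nu: K^*\to\mathbb{R}$ with value group $G$ and residue field $k$. Let $T$ be an algebraic torus over $K$ with character lattice $M$, let $N_G=\operatorname{Hom}(M,G)$, and let $X\subset T$ be a subvariety. Then for any $v\in N_G$ and any $\underline{x}\in X_v(k)$, the set $$\mathfrak{Trop}^{-1}(\underline{x})\cap X(K)$$ is Zariski dense in $X(K)$.
   Context: Setting: $K$ is an algebraically closed field, $\nu:K^*\to\mathbb{R}$ a nonarchimedean valuation with image $G\subset\mathbb{R}$, $R\subset K$ the valuation ring, $\mathfrak{m}\subset R$ its maximal ideal, $k=R/\mathfrak{m}$. $T$ is a torus with character lattice $M$ and coordinate ring $K[M]$; the character of $u\in M$ is written $\chi^u$ as a function on points and $x^u$ as an element of $K[M]$. $N_G=\operatorname{Hom}(M,G)\subset N_{\mathbb{R}}=\operatorname{Hom}(M,\mathbb{R})$, and $\langle u,v\rangle$ denotes the pairing. For $x\in T(K)$, $\operatorname{ev}_x:M\to K^*$ is the homomorphism $u\mapsto\chi^u(x)$. Tropicalization: $\operatorname{Trop}:T(K)\to N_G\subset N_{\mathbb{R}}$ sends $x$ to the homomorphism $\nu\circ\operatorname{ev}_x$, i.e. $u\mapsto\nu(\chi^u(x))$. Tilted group ring and exploded tropicalization: for $v\in N_G$ let $R[M]^v\subset K[M]$ be the $R$-subalgebra of Laurent polynomials $\sum a_ux^u$ such that $\nu(a_u)\ge\langle u,v\rangle$ whenever $a_u\neq0$, and let $T_v=\operatorname{Spec}R[M]^v$, which is a $T$-torsor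 defined over $R$. Given $x\in\operatorname{Trop}^{-1}(v)$, the $R$-algebra map $R[M]^v\to R$ taking $a_ux^u$ to $a_u/\operatorname{ev}_x(u)$ is a point of $T_v(R)$, and this gives a bijection $\operatorname{Trop}^{-1}(v)\to T_v(R)$. Composing with the residue map $T_v(R)\to T_v(k)$ gives the tropical residue $\underline{x}\in T_v(k)$ of $x$. The exploded tropicalization map is $\mathfrak{Trop}:T(K)\to\coprod_{v\in N_G}T_v(k)$, sending $x\in\operatorname{Trop}^{-1}(v)$ to $\underline{x}\in T_v(k)$. Tropical reduction: for $s\in\mathbb{R}$ let $\mathfrak{m}^s$ (resp. $\mathfrak{m}^s_+$) be the fractional ideal of $R$ whose nonzero elements are the elements of $K^*$ of valuation $\ge s$ (resp. $>s$), and let $k^s=\mathfrak{m}^s/\mathfrak{m}^s_+$. Then $R[M]^v=\bigoplus_{u\in M}\mathfrak{m}^{\langle u,v\rangle}$, and the coordinate ring of the fiber of $T_v$ over the closed point of $\operatorname{Spec}R$ is the quotient $k[T_v]=\bigoplus_{u\in M}k^{\langle u,v\rangle}$. For $f\in R[M]^v$ the initial form $\operatorname{in}_v(f)$ is the image of $f$ in $k[T_v]$. The tropical reduction $X_v$ is the $k$-subvariety of $T_v$ cut out by the initial forms $\operatorname{in}_v(f)$ of all Laurent polynomials $f$ in the intersection of $R[M]^v$ and the ideal of $X$ in $K[M]$.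
   Formalization: The valuation is assumed nontrivial (the claim fails for the trivial one when dim X > 0), subvariety means irreducible closed subvariety, and the ideal of X is taken with x^u evaluated as 1/χ^u(x), matching the sign convention of R[M]^v and its R-points. *)

(* Defs.v *)
From HB Require Import structures.
From mathcomp Require Import all_boot all_order all_algebra finmap.
From mathcomp Require Import monalg.
From mathcomp Require Import boolp classical_sets reals topology_structure.

Set Implicit Arguments.
Unset Strict Implicit.
Unset Printing Implicit Defensive.

Import Order.TTheory GRing.Theory Num.Theory.
Local Open Scope ring_scope.
Local Open Scope quotient_scope.

Definition is_lattice (M : zmodType) : Prop :=
  exists n (e : {additive M -> 'rV[int]_n}), bijective e.

(* [monalg] only puts a ring structure on [{malg K[M]}] when [M] is a monoid
   whose only unit is the identity, which excludes groups; hence this copy of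
   its additive structure with the convolution product of the group [M]. *)
Definition laurent (K : fieldType) (M : zmodType) : Type := {malg K[M]}.

Section LaurentRing.
Variables (K : fieldType) (M : zmodType).
Local Notation L := (laurent K M).

HB.instance Definition _ := GRing.Zmodule.on L.

Implicit Types f g h : L.

Definition laurent1 : L := << 1 *g 0 >>.

Definition laurent_mul f g : L :=
  \sum_(u <- msupp f) \sum_(w <- msupp g) << f@_u * g@_w *g u + w >>.

Lemma laurent_mulC : commutative laurent_mul.
Proof.
move=> f g; rewrite /laurent_mul exchange_big /=.
apply: eq_bigr => u _; apply: eq_bigr => w _.
by rewrite mulrC addrC.
Qed.

Lemma laurent_mulw (d1 d2 : {fset M}) f g :
  (msupp f `<=` d1)%fset -> (msupp g `<=` d2)%fset ->
  laurent_mul f g =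
  \sum_(u <- d1) \sum_(w <- d2) << f@_u * g@_w *g u + w >>.
Proof.
move=> le1 le2; rewrite /laurent_mul (big_fset_incl _ le1) /=.
  apply/eq_bigr=> k1 _; apply/big_fset_incl => // k _ /mcoeff_outdom ->.
  by rewrite mulr0 monalgU0.
move=> k _ /mcoeff_outdom fk.
by rewrite big1 => // k' _; rewrite fk mul0r monalgU0.
Qed.

Lemma laurent_mul0f : left_zero 0 laurent_mul.
Proof. by move=> f; rewrite /laurent_mul msupp0 big_seq_fset0. Qed.

Lemma laurent_mulf0 : right_zero 0 laurent_mul.
Proof. by move=> f; rewrite laurent_mulC laurent_mul0f. Qed.

Lemma laurent_mulUU a b u w :
  laurent_mul << a *g u >> << b *g w >> = << a * b *g u + w >>.
Proof.
rewrite (laurent_mulw (d1 := [fset u]%fset) (d2 := [fset w]%fset)) ?msuppU_le //.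
by rewrite !big_seq_fset1 !mcoeffUU.
Qed.

Lemma laurent_mulDl : left_distributive laurent_mul +%R.
Proof.
move=> f g h; rewrite [in RHS](laurent_mulw (fsubsetUl _ (msupp g)) (fsubset_refl _)).
rewrite [in RHS](laurent_mulw (fsubsetUr (msupp f) _) (fsubset_refl _)).
rewrite (laurent_mulw (msuppD_le _ _) (fsubset_refl _)).
rewrite -big_split /=; apply/eq_bigr=> k1 _.
rewrite -big_split /=; apply/eq_bigr=> k2 _.
by rewrite mcoeffD mulrDl monalgUD.
Qed.

Lemma laurent_mulDr : right_distributive laurent_mul +%R.
Proof.
by move=> f g h; rewrite laurent_mulC laurent_mulDl !(laurent_mulC _ f).
Qed.

Lemma laurent_mul1f : left_id laurent1 laurent_mul.
Proof.
move=> f; rewrite (laurent_mulw (d1 := [fset 0]%fset) (msuppU_le) (fsubset_refl _)).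
rewrite big_seq_fset1 [RHS]monalgE; apply: eq_bigr => u _.
by rewrite mcoeffUU mul1r add0r.
Qed.

Lemma laurent_mulEl f g :
  laurent_mul f g = \sum_(u <- msupp f) laurent_mul << f@_u *g u >> g.
Proof.
apply/eq_bigr=> u _.
rewrite (laurent_mulw (d1 := [fset u]%fset) (msuppU_le) (fsubset_refl _)).
by rewrite big_seq_fset1 mcoeffUU.
Qed.

Lemma laurent_mulA : associative laurent_mul.
Proof.
have mul_suml h (s : seq M) (F : M -> L) :
    laurent_mul (\sum_(i <- s) F i) h = \sum_(i <- s) laurent_mul (F i) h.
  exact: (big_morph (laurent_mul^~ h) (fun _ _ => laurent_mulDl _ _ _)
            (laurent_mul0f _)).
have mul_sumr h (s : seq M) (F : M -> L) :
    laurent_mul h (\sum_(i <- s) F i) = \sum_(i <- s) laurent_mul h (F i).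
  exact: (big_morph (laurent_mul h) (fun _ _ => laurent_mulDr _ _ _)
            (laurent_mulf0 _)).
have mulEr f g : laurent_mul f g = \sum_(u <- msupp g) laurent_mul f << g@_u *g u >>.
  rewrite laurent_mulC laurent_mulEl; apply: eq_bigr => u _.
  exact: laurent_mulC.
move=> f g h; rewrite laurent_mulEl [laurent_mul f g]laurent_mulEl mul_suml.
apply: eq_bigr => u _; rewrite [laurent_mul g h]laurent_mulEl mul_sumr.
rewrite [laurent_mul << _ *g _ >> g]mulEr mul_suml; apply: eq_bigr => w _.
rewrite [laurent_mul << g@_w *g w >> h]mulEr mul_sumr [RHS]mulEr.
by apply: eq_bigr => z _; rewrite !laurent_mulUU mulrA addrA.
Qed.

Lemma laurent1_neq0 : laurent1 != 0.
Proof. by rewrite monalgU_eq0 oner_neq0. Qed.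

HB.instance Definition _ := GRing.Zmodule_isComNzRing.Build L
  laurent_mulA laurent_mulC laurent_mul1f laurent_mulDl laurent1_neq0.

Lemma laurent1E : 1 = << 1 *g 0 >> :> L.
Proof. by []. Qed.

Lemma laurentUM a b u w :
  (<< a *g u >> : L) * << b *g w >> = << a * b *g u + w >>.
Proof. exact: laurent_mulUU. Qed.

End LaurentRing.

(* A K-point of the torus with character lattice M is given by its evaluation
   homomorphism M -> K^*. *)
Record torus (K : fieldType) (M : zmodType) := Torus {
  ev :> M -> K;
  ev_neq0 : forall u, ev u != 0;
  evD : forall u w, ev (u + w) = ev u * ev w
}.

Section Torus.
Variables (K : fieldType) (M : zmodType).
Local Notation T := (torus K M).
Local Notation L := (laurent K M).
Implicit Types (x y : T) (f g : L).

HB.instance Definition _ := gen_eqMixin T.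
HB.instance Definition _ := gen_choiceMixin T.

Lemma torus_ext x y : (forall u, x u = y u) -> x = y.
Proof.
case: x y => [a a0 aD] [b b0 bD] /= /funext eab.
by subst b; congr Torus; apply: Prop_irrelevance.
Qed.

Lemma ev0 x : x 0 = 1.
Proof.
by apply: (mulfI (ev_neq0 x 0)); rewrite -evD addr0 mulr1.
Qed.

(* The monomial x^u takes the value 1/chi^u(x) at x, so that restricting this
   map to R[M]^v is a_u x^u |-> a_u / ev_x(u), the R-point of T_v defined by x.
   The same identification of K[M] with the coordinate ring of T is used for
   the ideal of a subvariety X: since R[M]^v is defined by nu(a_u) >= <u, v>, evaluating
   x^u as chi^u there would separate X_v from the tropical residues of the
   points of X (compare [exploded_trop_reduction] below).  Substituting x^(-u)
   for x^u gives the convention nu(a_u) + <u, v> >= 0 and x^u |-> chi^u(x). *)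
Definition leval x f : K := \sum_(u <- msupp f) f@_u / x u.

Lemma levalw x f (d : {fset M}) : (msupp f `<=` d)%fset ->
  leval x f = \sum_(u <- d) f@_u / x u.
Proof.
move=> le; rewrite /leval (big_fset_incl _ le) // => u _ /mcoeff_outdom ->.
by rewrite mul0r.
Qed.

Lemma leval_zmod x : zmod_morphism (leval x).
Proof.
move=> f g; rewrite (levalw x (msuppB_le f g)).
rewrite (levalw x (fsubsetUl _ (msupp g))) (levalw x (fsubsetUr (msupp f) _)).
rewrite -sumrB; apply: eq_bigr => u _; rewrite -mulrBl.
by rewrite raddfB.
Qed.

HB.instance Definition _ x := GRing.isZmodMorphism.Build L K (leval x) (leval_zmod x).

Lemma levalU x a u : leval x << a *g u >> = a / x u.
Proof. by rewrite (levalw x msuppU_le) big_seq_fset1 mcoeffUU. Qed.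

Lemma leval_monoid x : monoid_morphism (leval x).
Proof.
split=> [|f g]; first by rewrite levalU ev0 divr1.
rewrite [f * g]/(laurent_mul f g) /laurent_mul raddf_sum /leval mulr_suml.
apply: eq_bigr => u _; rewrite raddf_sum mulr_sumr; apply: eq_bigr => w _ /=.
by rewrite levalU evD invfM mulrACA.
Qed.

HB.instance Definition _ x :=
  GRing.isMonoidMorphism.Build L K (leval x) (leval_monoid x).

End Torus.

Section Zariski.
Local Open Scope classical_set_scope.
Variables (K : fieldType) (M : zmodType).
Local Notation T := (torus K M).
Local Notation L := (laurent K M).

Definition zero_locus (S : set L) : set T :=
  [set x | forall f, S f -> leval x f = 0].

Definition vanishing_ideal (X : set T) : set L :=
  [set f | forall x, X x -> leval x f = 0].

Definition zariski_open (A : set T) : Prop :=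
  exists S : set L, A = ~` zero_locus S.

Lemma zariski_openP (A : set T) : zariski_open A <->
  exists S : set L, forall x, A x <-> exists2 f, S f & leval x f != 0.
Proof.
split=> [[S ->]|[S AS]]; exists S.
  move=> x; split; first by move=> /existsNP[f /not_implyP[Sf /eqP fx]]; exists f.
  by case=> f Sf /eqP fx /(_ f Sf).
apply/seteqP; split=> x.
  by move=> /AS[f Sf /eqP fx] /(_ f Sf).
by move=> /existsNP[f /not_implyP[Sf /eqP fx]]; apply/AS; exists f.
Qed.

Lemma zariski_openT : zariski_open setT.
Proof.
apply/zariski_openP; exists [set 1] => x; split=> // _; exists 1 => //.
by rewrite rmorph1 oner_neq0.
Qed.

Lemma zariski_openI : setI_closed zariski_open.
Proof.
move=> A B /zariski_openP[S AS] /zariski_openP[S' BS']; apply/zariski_openP.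
exists [set h | exists f g, [/\ S f, S' g & h = f * g]] => x; split.
  move=> [/AS[f Sf fx] /BS'[g S'g gx]]; exists (f * g); first by exists f, g.
  by rewrite rmorphM mulf_neq0.
case=> _ [f [g [Sf S'g ->]]]; rewrite rmorphM mulf_eq0 negb_or => /andP[fx gx].
by split; [apply/AS; exists f|apply/BS'; exists g].
Qed.

Lemma zariski_open_bigU (I : Type) (F : I -> set T) :
  (forall i, zariski_open (F i)) -> zariski_open (\bigcup_i F i).
Proof.
move=> oF.
have /choice[S FS] : forall i, exists S : set L,
    forall x, F i x <-> exists2 f, S f & leval x f != 0.
  by move=> i; apply/zariski_openP.
apply/zariski_openP; exists (\bigcup_i S i) => x; split.
  by move=> [i _ /FS[f Sf fx]]; exists f => //; exists i.
by move=> [f [i _ Sf] fx]; exists i => //; apply/FS; exists f.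
Qed.

HB.instance Definition _ := isOpenTopological.Build T
  zariski_openT zariski_openI zariski_open_bigU.

Lemma closed_zariskiP (Z : set T) :
  closed Z <-> exists S : set L, Z = zero_locus S.
Proof.
rewrite -openC; split=> [[S CZ]|[S ->]]; last by exists S.
by exists S; rewrite -[LHS]setCK CZ setCK.
Qed.

Definition irreducible (Z : set T) : Prop :=
  Z !=set0 /\ forall A B, closed A -> closed B ->
    Z `<=` A `|` B -> Z `<=` A \/ Z `<=` B.

(* A closed subvariety, given by its K-points; its ideal in K[M] is
   [vanishing_ideal X]. *)
Definition subvariety (X : set T) : Prop := closed X /\ irreducible X.

End Zariski.

(* The value at 0 is irrelevant: nu stands for a map K^* -> R. *)
Record valuation (K : fieldType) (R : realType) := Valuation {
  vval :> K -> R;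
  vvalM : forall a b, a != 0 -> b != 0 -> vval (a * b) = vval a + vval b;
  vvalD : forall a b, a != 0 -> b != 0 -> a + b != 0 ->
    Num.min (vval a) (vval b) <= vval (a + b)
}.

(* For the trivial valuation k = K and the exploded tropicalization is
   injective, so that its fibers are dense only in points. *)
Definition nontrivial (K : fieldType) (R : realType) (nu : valuation K R) :=
  exists2 a : K, a != 0 & nu a != 0.

Section Valuation.
Variables (K : fieldType) (R : realType) (nu : valuation K R).

(* The fractional ideals m^s and m^s_+. *)
Definition mge (s : R) : {pred K} := [pred a | (a == 0) || (s <= nu a)].
Definition mgt (s : R) : {pred K} := [pred a | (a == 0) || (s < nu a)].

Lemma vval1 : nu 1 = 0.
Proof.
have := vvalM nu (oner_neq0 K) (oner_neq0 K); rewrite mulr1 => /eqP.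
by rewrite -subr_eq0 opprD addNKr oppr_eq0 => /eqP.
Qed.

Lemma vvalN1 : nu (- 1) = 0.
Proof.
have N1 : - 1 != 0 :> K by rewrite oppr_eq0 oner_neq0.
have := vvalM nu N1 N1; rewrite mulrNN mulr1 vval1 => /esym/eqP.
by rewrite -mulr2n mulrn_eq0 => /eqP.
Qed.

Lemma vvalV a : a != 0 -> nu a^-1 = - nu a.
Proof.
move=> a0; apply/eqP; rewrite -addr_eq0 -(vvalM nu) ?invr_eq0 //.
by rewrite mulVf // vval1.
Qed.

Lemma mge0 s : 0 \in mge s. Proof. by rewrite inE eqxx. Qed.
Lemma mgt0 s : 0 \in mgt s. Proof. by rewrite inE eqxx. Qed.

Lemma mgeM s t a b : a \in mge s -> b \in mge t -> a * b \in mge (s + t).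
Proof.
rewrite !inE mulf_eq0; case: eqVneq => //= a0 sa; case: eqVneq => //= b0 tb.
by rewrite vvalM // lerD.
Qed.

Lemma mgtM s t a b : a \in mge s -> b \in mgt t -> a * b \in mgt (s + t).
Proof.
rewrite !inE mulf_eq0; case: eqVneq => //= a0 sa; case: eqVneq => //= b0 tb.
by rewrite vvalM // ler_ltD.
Qed.

Lemma mge1 : 1 \in mge 0. Proof. by rewrite inE vval1 lexx orbT. Qed.
Lemma mgeN1 : - 1 \in mge 0. Proof. by rewrite inE vvalN1 lexx orbT. Qed.

Lemma mgeD s a b : a \in mge s -> b \in mge s -> a + b \in mge s.
Proof.
rewrite !inE; have [->|a0] /= := eqVneq a 0; first by rewrite add0r.
have [->|b0] /= := eqVneq b 0; first by rewrite addr0 (negPf a0).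
move=> sa sb; case: eqVneq => //= ab0.
by apply: le_trans (vvalD nu a0 b0 ab0); rewrite le_min sa.
Qed.

Lemma mgtD s a b : a \in mgt s -> b \in mgt s -> a + b \in mgt s.
Proof.
rewrite !inE; have [->|a0] /= := eqVneq a 0; first by rewrite add0r.
have [->|b0] /= := eqVneq b 0; first by rewrite addr0 (negPf a0).
move=> sa sb; case: eqVneq => //= ab0.
by apply: lt_le_trans (vvalD nu a0 b0 ab0); rewrite lt_min sa.
Qed.

Lemma mgeN s a : a \in mge s -> - a \in mge s.
Proof. by move=> /(mgeM mgeN1); rewrite mulN1r add0r. Qed.

Lemma mgtN s a : a \in mgt s -> - a \in mgt s.
Proof. by move=> /(mgtM mgeN1); rewrite mulN1r add0r. Qed.

Lemma mge_sum s (I : Type) (r : seq I) (F : I -> K) :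
  (forall i, F i \in mge s) -> \sum_(i <- r) F i \in mge s.
Proof.
by move=> Fs; elim/big_rec: _ => [|i y _]; [exact: mge0|exact: mgeD].
Qed.

Lemma mgt_sum s (I : Type) (r : seq I) (F : I -> K) :
  (forall i, F i \in mgt s) -> \sum_(i <- r) F i \in mgt s.
Proof.
by move=> Fs; elim/big_rec: _ => [|i y _]; [exact: mgt0|exact: mgtD].
Qed.

Definition vring_pred : {pred K} := mge 0.

Fact vring_subring_closed : subring_closed vring_pred.
Proof.
split; first exact: mge1.
  by move=> a b ? ?; apply: mgeD => //; apply: mgeN.
by move=> a b ? ?; rewrite /vring_pred -[0]addr0; apply: mgeM.
Qed.
HB.instance Definition _ :=
  GRing.isSubringClosed.Build K vring_pred vring_subring_closed.

(* The valuation ring, called R in the expressions R[M]^v and T_v(R) below. *)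
Record vring := VRing { vring_val :> K; vring_valP : vring_val \in vring_pred }.
HB.instance Definition _ := [isSub for vring_val].
HB.instance Definition _ := [Choice of vring by <:].
HB.instance Definition _ := [SubChoice_isSubComNzRing of vring by <:].

Definition maxideal : {pred vring} := [pred a : vring | val a \in mgt 0].

Fact maxideal_idealr_closed : idealr_closed maxideal.
Proof.
split; rewrite ?inE /=.
- by rewrite eqxx.
- by rewrite vval1 ltxx orbF oner_neq0.
move=> a b c; rewrite !inE => hb hc.
have := mgtD (mgtM (valP a) (b := val b) (t := 0) hb) (b := val c).
by rewrite addr0; apply.
Qed.
HB.instance Definition _ := isIdealr.Build vring maxideal maxideal_idealr_closed.

Definition residue_field : Type := {ideal_quot maxideal}.
HB.instance Definition _ := GRing.ComNzRing.on residue_field.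

Definition residue : vring -> residue_field := \pi_{ideal_quot maxideal}.
HB.instance Definition _ := GRing.RMorphism.on residue.

Lemma residue_eq0 a : (residue a == 0) = (a \in maxideal).
Proof.
rewrite -(rmorph0 residue) -[in RHS](subr0 a) Quotient.idealrBE.
by rewrite /residue.
Qed.

End Valuation.

Section Tropicalization.
Variables (K : fieldType) (R : realType) (nu : valuation K R) (M : zmodType).
Local Notation L := (laurent K M).
Local Notation T := (torus K M).

(* N_G = Hom(M, G), where G is the image of nu. *)
Record NG := MkNG {
  pairing :> M -> R;
  pairingD : forall u w, pairing (u + w) = pairing u + pairing w;
  pairingG : forall u, exists2 a, a != 0 & nu a = pairing u
}.

Lemma NG_ext (v w : NG) : (forall u, v u = w u) -> v = w.
Proof.
case: v w => [a aD aG] [b bD bG] /= /funext eab; subst b.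
by congr MkNG; apply: Prop_irrelevance.
Qed.

Lemma pairing0 (v : NG) : v 0 = 0.
Proof. by apply: (addrI (v 0)); rewrite -pairingD !addr0. Qed.

Fact trop_additive (x : T) u w : nu (x (u + w)) = nu (x u) + nu (x w).
Proof. by rewrite evD vvalM ?ev_neq0. Qed.

Fact trop_value_group (x : T) u : exists2 a, a != 0 & nu a = nu (x u).
Proof. by exists (x u); rewrite ?ev_neq0. Qed.

Definition trop (x : T) : NG := MkNG (trop_additive x) (trop_value_group x).

Section Tilted.
Variable v : NG.

(* R[M]^v, the Laurent polynomials whose coefficient of x^u is in m^<u,v>. *)
Definition tilted_pred : {pred L} :=
  [pred f : L | all (fun u => f@_u \in mge nu (v u)) (msupp f)].

Lemma tilted_predP f : reflect (forall u, f@_u \in mge nu (v u)) (f \in tilted_pred).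
Proof.
apply: (iffP allP) => fv u; last by move=> _; apply: fv.
by case: (boolP (u \in msupp f)) => [/fv//|/mcoeff_outdom ->]; apply: mge0.
Qed.

Lemma mcoeff_laurentM (f g : L) w : (f * g)@_w =
  \sum_(u <- msupp f) \sum_(u' <- msupp g) (f@_u * g@_u') *+ (u + u' == w).
Proof.
rewrite [f * g]/(laurent_mul f g) /laurent_mul raddf_sum /=.
apply: eq_bigr => u _; rewrite raddf_sum /=; apply: eq_bigr => u' _.
by rewrite mcoeffU.
Qed.

Fact tilted_subring_closed : subring_closed tilted_pred.
Proof.
split.
- apply/tilted_predP => u; rewrite laurent1E mcoeffU; case: eqVneq => [<-|_] /=.
    by rewrite pairing0 mge1.
  exact: mge0.
- move=> f g /tilted_predP fv /tilted_predP gv; apply/tilted_predP => u.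
  by rewrite raddfB /=; apply: mgeD (fv u) (mgeN (gv u)).
- move=> f g /tilted_predP fv /tilted_predP gv; apply/tilted_predP => w.
  rewrite mcoeff_laurentM; apply: mge_sum => u; apply: mge_sum => u'.
  case: eqVneq => [<-|_] /=; last exact: mge0.
  by rewrite pairingD; apply: mgeM.
Qed.
HB.instance Definition _ :=
  GRing.isSubringClosed.Build L tilted_pred tilted_subring_closed.

Record tilted := Tilted { tilted_val :> L; tilted_valP : tilted_val \in tilted_pred }.
HB.instance Definition _ := [isSub for tilted_val].
HB.instance Definition _ := [Choice of tilted by <:].
HB.instance Definition _ := [SubChoice_isSubComNzRing of tilted by <:].

Fact tilted_val_zmod : zmod_morphism tilted_val. Proof. by []. Qed.
Fact tilted_val_monoid : monoid_morphism tilted_val. Proof. by []. Qed.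
HB.instance Definition _ :=
  GRing.isZmodMorphism.Build tilted L tilted_val tilted_val_zmod.
HB.instance Definition _ :=
  GRing.isMonoidMorphism.Build tilted L tilted_val tilted_val_monoid.

Fact tiltedC_subproof (a : vring nu) : (<< val a *g 0 >> : L) \in tilted_pred.
Proof.
apply/tilted_predP => u; rewrite mcoeffU; case: eqVneq => [<-|_] /=.
  by rewrite pairing0; apply: (valP a).
exact: mge0.
Qed.

(* The structure map of R[M]^v as an algebra over the valuation ring. *)
Definition tiltedC (a : vring nu) : tilted := Tilted (tiltedC_subproof a).

Definition tilted_plus : {pred tilted} :=
  [pred f : tilted | all (fun u => (f : L)@_u \in mgt nu (v u)) (msupp (f : L))].

Lemma tilted_plusP (f : tilted) :
  reflect (forall u, (f : L)@_u \in mgt nu (v u)) (f \in tilted_plus).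
Proof.
apply: (iffP allP) => fv u; last by move=> _; apply: fv.
by case: (boolP (u \in msupp (f : L))) => [/fv//|/mcoeff_outdom ->]; apply: mgt0.
Qed.

Fact tilted_plus_idealr_closed : idealr_closed tilted_plus.
Proof.
split.
- by apply/tilted_plusP => u; rewrite !raddf0 mgt0.
- apply/tilted_plusP => /(_ 0); rewrite rmorph1 laurent1E mcoeffUU inE vval1 pairing0.
  by rewrite ltxx oner_eq0.
move=> f g h /tilted_plusP gv /tilted_plusP hv; apply/tilted_plusP => w.
rewrite rmorphD rmorphM raddfD /=; apply: mgtD; last exact: hv.
rewrite mcoeff_laurentM; apply: mgt_sum => u; apply: mgt_sum => u'.
case: eqVneq => [<-|_] /=; last exact: mgt0.
rewrite pairingD; apply: mgtM; last exact: gv.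
by apply/tilted_predP; apply: (tilted_valP f).
Qed.
HB.instance Definition _ :=
  isIdealr.Build tilted tilted_plus tilted_plus_idealr_closed.

(* The coordinate ring k[T_v] of the special fiber of T_v: R[M]^v and
   [tilted_plus] are the direct sums over u of m^<u,v> and m_+^<u,v>, so the
   quotient is the direct sum of the k^<u,v>. *)
Definition kT : Type := {ideal_quot tilted_plus}.
HB.instance Definition _ := GRing.ComNzRing.on kT.

Definition initial_form : tilted -> kT := \pi_{ideal_quot tilted_plus}.
HB.instance Definition _ := GRing.RMorphism.on initial_form.

Lemma initial_formK (a : kT) : initial_form (repr a) = a.
Proof. exact: reprK. Qed.

Lemma initial_form_eq0 (f : tilted) : (initial_form f == 0) = (f \in tilted_plus).
Proof.
by rewrite -(rmorph0 initial_form) -[in RHS](subr0 f) Quotient.idealrBE.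
Qed.

(* T_v(R): homomorphisms R[M]^v -> R of algebras over the valuation ring. *)
Record Tv_R := TvR {
  TvR_fun :> tilted -> vring nu;
  TvR_zmod : zmod_morphism TvR_fun;
  TvR_monoid : monoid_morphism TvR_fun;
  TvR_const : forall a, TvR_fun (tiltedC a) = a
}.
HB.instance Definition _ (p : Tv_R) :=
  GRing.isZmodMorphism.Build tilted (vring nu) p (TvR_zmod p).
HB.instance Definition _ (p : Tv_R) :=
  GRing.isMonoidMorphism.Build tilted (vring nu) p (TvR_monoid p).

(* T_v(k): homomorphisms k[T_v] -> k of algebras over the residue field, where
   the class of a in k acts on k[T_v] as the class of the constant a. *)
Record Tv_k := Tvk {
  Tvk_fun :> kT -> residue_field nu;
  Tvk_zmod : zmod_morphism Tvk_fun;
  Tvk_monoid : monoid_morphism Tvk_fun;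
  Tvk_const : forall a, Tvk_fun (initial_form (tiltedC a)) = residue a
}.
HB.instance Definition _ (p : Tv_k) :=
  GRing.isZmodMorphism.Build kT (residue_field nu) p (Tvk_zmod p).
HB.instance Definition _ (p : Tv_k) :=
  GRing.isMonoidMorphism.Build kT (residue_field nu) p (Tvk_monoid p).

Lemma Tv_k_ext (p q : Tv_k) :
  (forall f, p (initial_form f) = q (initial_form f)) -> p = q.
Proof.
move=> epq; have {epq} : Tvk_fun p = Tvk_fun q.
  by apply/funext => a; rewrite -[a]initial_formK; apply: epq.
case: p q => [a ? ? ?] [b ? ? ?] /= eab; subst b.
by congr Tvk; apply: Prop_irrelevance.
Qed.

Lemma TvR_plus (p : Tv_R) (f : tilted) : f \in tilted_plus -> p f \in @maxideal _ _ nu.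
Proof.
move=> /tilted_plusP fv.
have termP u : << (f : L)@_u *g u >> \in tilted_pred.
  apply/tilted_predP => w; rewrite mcoeffU; case: eqVneq => [<-|_] /=.
    by apply/tilted_predP; apply: (tilted_valP f).
  exact: mge0.
have -> : f = \sum_(u <- msupp (f : L)) Tilted (termP u).
  by apply: val_inj; rewrite raddf_sum /=; apply: monalgE.
rewrite raddf_sum; apply: rpred_sum => u _.
have [b b0 bv] := pairingG v u.
have bP : (<< b *g u >> : L) \in tilted_pred.
  apply/tilted_predP => w; rewrite mcoeffU; case: eqVneq => [<-|_] /=.
    by rewrite inE bv lexx orbT.
  exact: mge0.
have cP : (f : L)@_u / b \in mgt nu 0.
  have bVP : b^-1 \in mge nu (- v u) by rewrite inE vvalV // bv lexx orbT.
  by have := mgtM bVP (fv u); rewrite addNr mulrC.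
have cR : (f : L)@_u / b \in vring_pred nu.
  by move: cP; rewrite !inE => /orP[->//|/ltW ->]; rewrite orbT.
have -> : Tilted (termP u) = tiltedC (VRing cR) * Tilted bP.
  by apply: val_inj; rewrite rmorphM /= laurentUM add0r divfK.
rewrite /= rmorphM /= mulrC TvR_const.
by apply: (@idealMr _ (@maxideal _ _ nu)); rewrite inE.
Qed.

Section ResidueMap.
Variable p : Tv_R.

Definition residue_fun (a : kT) : residue_field nu := residue (p (repr a)).

Lemma residue_funE f : residue_fun (initial_form f) = residue (p f).
Proof.
apply/eqP; rewrite -subr_eq0 /residue_fun -rmorphB -rmorphB residue_eq0.
by apply: TvR_plus; rewrite -initial_form_eq0 rmorphB subr_eq0 /= initial_formK.
Qed.

Fact residue_fun_zmod : zmod_morphism residue_fun.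
Proof.
move=> a b; rewrite -[a]initial_formK -[b]initial_formK.
by rewrite -rmorphB !residue_funE !rmorphB.
Qed.

Fact residue_fun_monoid : monoid_morphism residue_fun.
Proof.
split; first by rewrite -(rmorph1 initial_form) residue_funE !rmorph1.
move=> a b; rewrite -[a]initial_formK -[b]initial_formK.
by rewrite -rmorphM !residue_funE !rmorphM.
Qed.

Fact residue_fun_const a : residue_fun (initial_form (tiltedC a)) = residue a.
Proof. by rewrite residue_funE TvR_const. Qed.

Definition residue_map : Tv_k :=
  Tvk residue_fun_zmod residue_fun_monoid residue_fun_const.
End ResidueMap.

End Tilted.

Fact eval_vring (x : T) (f : tilted (trop x)) : leval x f \in vring_pred nu.
Proof.
apply: mge_sum => u.
have /tilted_predP/(_ u) fu := tilted_valP f.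
have xu : (x u)^-1 \in mge nu (- nu (x u)).
  by rewrite inE vvalV ?ev_neq0 // lexx orbT.
by have := mgeM fu xu; rewrite subrr.
Qed.

Definition torus_eval (x : T) (f : tilted (trop x)) : vring nu :=
  VRing (eval_vring f).

Fact torus_eval_zmod x : zmod_morphism (@torus_eval x).
Proof. by move=> f g; apply: val_inj; rewrite rmorphB /= rmorphB. Qed.

Fact torus_eval_monoid x : monoid_morphism (@torus_eval x).
Proof.
split; first by apply: val_inj; rewrite rmorph1 /= rmorph1.
by move=> f g; apply: val_inj; rewrite rmorphM /= rmorphM.
Qed.

Fact torus_eval_const x a : torus_eval (tiltedC (trop x) a) = a.
Proof. by apply: val_inj; rewrite /= levalU ev0 divr1. Qed.

(* The R-point of T_v defined by a point x of T(K) with v = trop x. *)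
Definition torus_point (x : T) : Tv_R (trop x) :=
  TvR (@torus_eval_zmod x) (@torus_eval_monoid x) (@torus_eval_const x).

Definition tropical_residue (x : T) : Tv_k (trop x) :=
  residue_map (torus_point x).

Definition exploded_trop (x : T) : {v : NG & Tv_k v} :=
  existT _ (trop x) (tropical_residue x).

Local Open Scope classical_set_scope.

(* The k-points of X_v. *)
Definition tropical_reduction (X : set T) (v : NG) : set (Tv_k v) :=
  [set p | forall f : tilted v, vanishing_ideal X f -> p (initial_form f) = 0].

Lemma exploded_trop_reduction (X : set T) (x : T) : X x ->
  tropical_reduction X (tropical_residue x).
Proof.
move=> Xx f fX; rewrite /= residue_funE /= -(rmorph0 (@residue _ _ nu)).
by congr residue; apply: val_inj; rewrite /= fX.
Qed.

End Tropicalization.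

(* Main.v *)
Require Import Defs.
From HB Require Import structures.
From mathcomp Require Import all_boot all_order all_algebra.
From mathcomp Require Import mpoly zify ring lra.
From mathcomp Require Import boolp classical_sets reals topology_structure.

(** The idea is to turn the tropical residue [xbar] into a residue point of an
    algebra over the valuation ring V and to lift that point by going down.

    Multiplying the monomials of a basis of M by suitable constants makes
    [xbar] take the value 1 on each of them ([unit_term_exists]).  Let A be the
    coordinate ring of X, let a_1, ..., a_n be the restrictions of these scaled
    monomials and a_0 = 1.  That [xbar] lies in X_v says that every polynomial
    relation between the a_i with coefficients in V holds at (1, ..., 1) modulo
    the maximal ideal ([residue_relation]).  A point c with coordinates in V,
    congruent to (1, ..., 1) and satisfying all these relations, gives a point
    of X in the fiber over [xbar].  Density asks in addition that c avoid the
    zeros of one given function that does not vanish identically on X.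

    To find c, put x_i = a_i Z in A[Z], the coordinates on the cone over X.
    Homogeneous relations can be scaled to have a unit coefficient and then be
    made monic by a linear change of coordinates, the residue field being
    infinite.  Hence the x_i are integral over a polynomial ring D = V[y_1, ...,
    y_d], where the y_l are V-linear combinations of the x_i
    ([noether_normalization]).  This is where the cone matters: the reduction of
    an inhomogeneous relation may have smaller degree than the relation, and
    the coordinates of X itself need not be integral over any such D.

    The ring D is completely integrally closed ([cic_mpoly]), so the relations
    between an integral element theta and the y_l are the multiples of one monic
    polynomial h over D ([monic_generator]).  Choose y in V^d above the image of
    the residue point.  Then h, evaluated at y, is monic over V and vanishes at
    the residue of theta, hence it has a root over that residue.  The
    specialization of D[theta] so obtained extends to all x_i
    ([lying_over]), with values that are integral over V and thus lie in V.
    Each coordinate of such a point is a root of a fixed monic polynomial over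
    V, so there are finitely many candidates, and if theta is a combination of
    the x_i that separates their residues ([separating_powers]), then the point
    found has the prescribed residue ([lift_residue_point]).

    Finally y may vary in a product of residue classes.  These are infinite,
    because the valuation is not trivial, so y can be chosen outside the zeros
    of any nonzero polynomial, in particular of the constant coefficient of an
    integral equation of the function to be avoided. *)

Set Implicit Arguments.
Unset Strict Implicit.
Unset Printing Implicit Defensive.

Import Order.TTheory GRing.Theory Num.Theory.
Local Open Scope ring_scope.

(** * Complete integral closedness *)

(** Usually stated for p / q in the field of fractions: if the powers of p / q
    have a common denominator c, then p / q is in D.  For a valuation ring the
    property says that its value group is archimedean.  Unlike integral
    closedness it passes to polynomial rings by looking at leading terms only. *)
Definition completely_integrally_closed (D : idomainType) : Prop :=
  forall c p q : D, c != 0 -> q != 0 ->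
    (forall j, exists z, c * p ^+ j = z * q ^+ j) -> exists z, p = z * q.

Lemma almost_integral_sub (D : comNzRingType) (c p q w : D) :
  (forall j, exists z, c * p ^+ j = z * q ^+ j) ->
  forall j, exists z, c * (p - w * q) ^+ j = z * q ^+ j.
Proof.
move=> cp j; rewrite exprBn mulr_sumr.
elim/big_ind: _ => [|_ _ [z1 ->] [z2 ->]|i _]; first by exists 0; rewrite mul0r.
  by exists (z1 + z2); rewrite mulrDl.
have [z zE] := cp (j - i)%N.
exists ((z * (-1) ^+ i * w ^+ i) *+ 'C(j, i)).
rewrite mulrnAr mulrnAl; congr (_ *+ _).
have le_ij : (i <= j)%N by rewrite -ltnS.
have -> : q ^+ j = q ^+ (j - i) * q ^+ i by rewrite -exprD subnK.
by rewrite exprMn; ring: zE.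
Qed.

(** Comparing leading coefficients shows that lc(q) divides lc(p), comparing
    degrees that deg q <= deg p.  Thus p has the same leading term as a multiple
    of q, and subtracting this multiple keeps the hypothesis. *)
Lemma cic_poly (D : idomainType) :
  completely_integrally_closed D -> completely_integrally_closed {poly D}.
Proof.
move=> cicD c p q c0 q0 cp.
have [n le_pn] := ubnP (size p); elim: n p le_pn cp => // n IHn p lt_pn cp.
have [->|p0] := eqVneq p 0; first by exists 0; rewrite mul0r.
have [e eE] : exists e, lead_coef p = e * lead_coef q.
  apply: (cicD (lead_coef c)); rewrite ?lead_coef_eq0 // => j.
  have [z /(congr1 lead_coef)] := cp j.
  by rewrite !lead_coefM !lead_coef_exp; exists (lead_coef z).
have e0 : e != 0 by apply: contra_neq p0 => e0; apply/eqP; rewrite -lead_coef_eq0 eE e0 mul0r.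
have le_qp : (size q <= size p)%N.
  (* deg c + j deg p >= j deg q for all j, and j > deg c decides *)
  have [z zE] := cp (size c).
  have z0 : z != 0.
    apply: contraTneq isT => z0; have := mulf_neq0 c0 (expf_neq0 (size c) p0).
    by rewrite zE z0 mul0r eqxx.
  have := congr1 (fun f : {poly D} => size f) zE.
  rewrite /= !size_mul ?expf_neq0 // => sE.
  have sp := size_exp p (size c); have sq := size_exp q (size c).
  have gt0 (f : {poly D}) : f != 0 -> (0 < size f)%N by rewrite size_poly_gt0.
  have := gt0 _ (expf_neq0 (size c) p0); have := gt0 _ (expf_neq0 (size c) q0).
  move: (gt0 _ c0) (gt0 _ p0) (gt0 _ q0) (gt0 _ z0) => c_gt0 p_gt0 q_gt0 z_gt0 qc_gt0 pc_gt0.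
  rewrite leqNgt; apply/negP => lt_pq.
  have : ((size p).-1 * size c + size c <= (size q).-1 * size c)%N.
    by rewrite -mulSnr leq_mul2r prednK // -ltnS prednK // lt_pq orbT.
  rewrite -sp -sq.
  have key P Q a b : (a + P).-1 = (b + Q).-1 -> (0 < P -> 0 < Q -> 0 < b ->
    P.-1 + a <= Q.-1 -> False)%N by lia.
  exact: key sE _ _ _.
set w := e *: 'X^(size p - size q).
have sw : size (w * q) = size p.
  have w0 : w != 0 by rewrite /w -mul_polyC mulf_neq0 ?polyC_eq0 // monic_neq0 ?monicXn.
  rewrite size_mul // size_scale //.
  by rewrite size_polyXn addSn /= subnK.
have [z zE] : exists z, p - w * q = z * q.
  apply: IHn; last exact: almost_integral_sub.
  have le_s : (size (p - w * q)%R <= size p)%N.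
    by rewrite (leq_trans (size_polyD _ _)) // size_polyN sw maxnn.
  suff : size (p - w * q) != size p.
    by move=> ne; rewrite -ltnS (leq_trans _ lt_pn) // ltnS ltn_neqAle ne.
  apply: contra_neqN p0 => /eqP sE; apply/eqP.
  have /eqP : lead_coef (p - w * q) = 0.
    rewrite lead_coefE sE coefB -[X in _ - _`_X.-1]sw -!lead_coefE lead_coefM lead_coefZ.
    by rewrite lead_coefXn mulr1 eE subrr.
  by rewrite lead_coef_eq0 -size_poly_eq0 sE size_poly_eq0.
by exists (z + w); rewrite mulrDl -zE subrK.
Qed.

(** The argument of [cic_poly] with leading monomials, by induction along the
    monomial order. *)
Lemma cic_mpoly (D : idomainType) n :
  completely_integrally_closed D -> completely_integrally_closed {mpoly D[n]}.
Proof.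
move=> cicD c p q c0 q0; move mE: (mlead p) => m.
elim/(@ltmwf n): m p mE => m IHm p mE cp.
have [->|p0] := eqVneq p 0; first by exists 0; rewrite mul0r.
have lreg (f : {mpoly D[n]}) : f != 0 -> GRing.lreg (mleadc f).
  by move=> f0; apply/lregP; rewrite mleadc_eq0.
have leadX (f : {mpoly D[n]}) j : f != 0 -> mleadc (f ^+ j) = mleadc f ^+ j.
  by move=> f0; rewrite mleadcX_proper //; apply: lreg.
have leadM (f g : {mpoly D[n]}) : f != 0 -> g != 0 -> mleadc (f * g) = mleadc f * mleadc g.
  by move=> f0 g0; rewrite mleadcM_proper // mulf_neq0 // mleadc_eq0.
have zneq0 z j : c * p ^+ j = z * q ^+ j -> z != 0.
  move=> zE; apply: contraTneq isT => z0.
  by have := mulf_neq0 c0 (expf_neq0 j p0); rewrite zE z0 mul0r eqxx.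
have [e eE] : exists e, mleadc p = e * mleadc q.
  apply: (cicD (mleadc c)); rewrite ?mleadc_eq0 // => j.
  have [z zE] := cp j; have z0 := zneq0 _ _ zE.
  exists (mleadc z); have := congr1 (fun f => mleadc f) zE.
  by rewrite /= !leadM ?expf_neq0 // !leadX.
have e0 : e != 0.
  by apply: contra_neq p0 => e0; apply/eqP; rewrite -mleadc_eq0 eE e0 mul0r.
have le_qp : (mlead q <= mlead p)%MM.
  apply/mnm_lepP => i; rewrite leqNgt; apply/negP => lt_pq.
  have [z zE] := cp (mlead c i).+1; have z0 := zneq0 _ _ zE.
  have := congr1 (fun f => mlead f i) zE.
  rewrite /= !mleadM ?expf_neq0 // !mleadX // !mnmDE !mulmnE => sE.
  have := leq_mul lt_pq (leqnn (mlead c i).+1).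
  by rewrite mulSn; lia.
set w : {mpoly D[n]} := e *: 'X_[mlead p - mlead q].
have w0 : w != 0.
  by rewrite /w -mul_mpolyC mulf_neq0 ?mpolyC_eq0 // -mleadc_eq0 mleadXm mcoeffX eqxx oner_eq0.
have wm : mlead (w * q) = mlead p.
  by rewrite mleadM // mleadZ // mleadXm submK.
have wc : (w * q)@_(mlead p) = mleadc p.
  by have := leadM _ _ w0 q0; rewrite wm => ->; rewrite eE /w mleadcZE mleadXm mcoeffX eqxx mulr1.
have [z zE] : exists z, p - w * q = z * q.
  have [->|d0] := eqVneq (p - w * q) 0; first by exists 0; rewrite mul0r.
  apply: (IHm (mlead (p - w * q))) => //; last exact: almost_integral_sub.
  rewrite -mE lt_neqAle; apply/andP; split.
    by apply: contra_neq d0 => dE; apply/eqP; rewrite -mleadc_eq0 dE mcoeffB wc subrr.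
  by have := mleadB_le p (w * q); rewrite wm joinxx.
by exists (z + w); rewrite mulrDl -zE subrK.
Qed.

(** * Extending specializations along integral elements *)

Section PowerVector.
Variables (P W : comNzRingType) (alpha : {rmorphism P -> W}).

Definition powers n (x : W) : 'cV[W]_n := \col_i x ^+ i.

Lemma horner_powers n (x : W) (u : {poly P}) (le_un : (size u <= n)%N) :
  (map_poly alpha u).[x] = \sum_(i < n) alpha u`_i * x ^+ i.
Proof.
rewrite (@horner_coef_wide _ n) ?(leq_trans (size_poly _ _)) //.
by apply: eq_bigr => i _; rewrite coef_map.
Qed.

(** This replaces multiplication by x on a finite module by a matrix over P, so
    that determinants turn relations satisfied by x into elements of P. *)
Lemma eigen_horner_mx n (C : 'M[P]_n.+1) (v : 'cV[W]_n.+1) (x : W) :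
  map_mx alpha C *m v = x *: v ->
  forall f, map_mx alpha (horner_mx C f) *m v = (map_poly alpha f).[x] *: v.
Proof.
move=> Cv; elim/poly_ind => [|f c IHf].
  by rewrite !rmorph0 mul0mx horner0 scale0r.
rewrite !rmorphD !rmorphM /= horner_mx_X horner_mx_C map_polyX map_polyC.
rewrite map_scalar_mx hornerD hornerM hornerX hornerC mulmxDl.
rewrite -mulmxE -mulmxA Cv -scalemxAr IHf scalerA mulrC mul_scalar_mx.
by rewrite -scalerDl.
Qed.

Lemma det_kernel0 n (C : 'M[P]_n.+1) (v : 'cV[W]_n.+1) :
  map_mx alpha C *m v = 0 -> v 0 0 = 1 -> alpha (\det C) = 0.
Proof.
move=> Cv v1; have := congr1 (mulmx (\adj (map_mx alpha C))) Cv.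
rewrite mulmx0 mulmxA mul_adj_mx mul_scalar_mx det_map_mx => /matrixP/(_ 0 0).
by rewrite !mxE v1 mulr1.
Qed.

End PowerVector.

(** The homomorphisms [alpha] and [beta] present the values of [beta] as a
    specialization of those of [alpha]: every relation that holds between the
    latter holds between the former.  The image of [beta] need only have K as
    its field of fractions. *)
Section LyingOver.
Variables (P W : comNzRingType) (K : closedFieldType).
Variables (alpha : {rmorphism P -> W}) (beta : {rmorphism P -> K}).
Hypothesis le_ker : forall p, alpha p = 0 -> beta p = 0.
Hypothesis beta_frac : forall a : K, exists p q, beta q != 0 /\ beta q * a = beta p.

(** If C is the companion matrix of an integral equation of x, then f(C) has
    the kernel vector (1, x, x^2, ...), hence its determinant is killed by
    [alpha] and so by [beta].  But [beta] maps it to a power of a. *)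
Lemma relation_not_constant (x : W) (f : {poly P}) (a : K) :
  integralOver alpha x -> (map_poly alpha f).[x] = 0 -> map_poly beta f = a%:P -> a = 0.
Proof.
move=> [F monF /eqP Fx] fx fa.
have [n sF] : exists n, size F = n.+2.
  case sF: (size F) => [|[|n]]; last by exists n.
    by move: (monic_neq0 monF); rewrite -size_poly_eq0 sF.
  have F1 : F = 1.
    have F0 : F = (F`_0)%:P by apply: size1_polyC; rewrite sF.
    by move/monicP: monF; rewrite lead_coefE sF /= => F1; rewrite F0 F1.
  by move/eqP: Fx; rewrite F1 rmorph1 hornerC oner_eq0.
pose C := \matrix_(i < n.+1, j < n.+1) (Pdiv.Ring.rmodp ('X^(i.+1) : {poly P}) F)`_j.
have Cv : map_mx alpha C *m powers n.+1 x = x *: powers n.+1 x.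
  apply/colP => i; rewrite !mxE.
  under eq_bigr do rewrite !mxE.
  rewrite -horner_powers; last first.
    by rewrite -ltnS -sF Pdiv.Ring.ltn_rmodpN0 ?monic_neq0.
  rewrite -exprS.
  have /(congr1 (fun p => (map_poly alpha p).[x])) := Pdiv.RingMonic.rdivp_eq monF 'X^(i.+1).
  by rewrite /= rmorphD rmorphM /= map_polyXn hornerD hornerM Fx mulr0 add0r hornerXn => ->.
have /le_ker : alpha (\det (horner_mx C f)) = 0.
  apply: (@det_kernel0 _ _ _ _ _ (powers n.+1 x)); last by rewrite mxE expr0.
  by rewrite (eigen_horner_mx Cv) fx scale0r.
rewrite -det_map_mx map_horner_mx fa horner_mx_C det_scalar => /eqP.
by rewrite expf_eq0 /= => /eqP.
Qed.

(** The images under [beta] of the relations of x span an ideal of K[Z], which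
    is proper by [relation_not_constant] and nonzero since x is integral; c is
    a root of its generator. *)
Theorem lying_over_root (x : W) : integralOver alpha x ->
  exists c : K, forall f, (map_poly alpha f).[x] = 0 -> (map_poly beta f).[c] = 0.
Proof.
move=> intx.
(* the K-span of the images of the relations of x, with denominators q *)
pose I (u : {poly K}) := exists q f,
  [/\ beta q != 0, (map_poly alpha f).[x] = 0 & map_poly beta f = beta q *: u].
have I_map f : (map_poly alpha f).[x] = 0 -> I (map_poly beta f).
  by move=> fx; exists 1, f; split; rewrite ?rmorph1 ?oner_eq0 // scale1r.
have ID u v : I u -> I v -> I (u + v).
  move=> [q [f [q0 fx fE]]] [q' [f' [q'0 fx' fE']]].
  exists (q * q'), (q' *: f + q *: f'); split.
  - by rewrite rmorphM mulf_neq0.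
  - by rewrite rmorphD /= !map_polyZ hornerD !hornerZ fx fx' !mulr0 addr0.
  - by rewrite rmorphD /= !map_polyZ fE fE' !scalerA scalerDr rmorphM mulrC.
have IZ a u : I u -> I (a *: u).
  move=> [q [f [q0 fx fE]]]; have [p [q' [q'0 aE]]] := beta_frac a.
  exists (q * q'), (p *: f); split.
  - by rewrite rmorphM mulf_neq0.
  - by rewrite map_polyZ hornerZ fx mulr0.
  - by rewrite map_polyZ fE !scalerA rmorphM -mulrA aE mulrC.
have IX u : I u -> I (u * 'X).
  move=> [q [f [q0 fx fE]]]; exists q, (f * 'X); split=> //.
    by rewrite rmorphM hornerM fx mul0r.
  by rewrite rmorphM /= map_polyX fE scalerAl.
have IM u w : I u -> I (u * w).
  move=> Iu; elim/poly_ind: w => [|w a Iw].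
    by rewrite mulr0 -(scale0r u); apply: IZ.
  rewrite mulrDr mulrA mulrC; apply: ID; first by rewrite mulrC; apply: IX.
  by rewrite mulrC mul_polyC; apply: IZ.
have [F monF /eqP Fx] := intx.
have [d [Id d0 dvd_d]] : exists d, [/\ I d, d != 0 & forall u, I u -> d %| u].
  have := I_map _ Fx; have : map_poly beta F != 0 by rewrite monic_neq0 // monic_map.
  move: (map_poly beta F) => u u0 Iu; have [n] := ubnP (size u).
  elim: n u u0 Iu => // n IHn u u0 Iu lt_un.
  have [dvd_u|] := pselect (forall w, I w -> u %| w); first by exists u.
  move=> /existsNP[w /not_implyP[Iw /negP ndvd]].
  apply: (IHn (w %% u)).
  - by apply: contra ndvd => /eqP wu0; apply/modp_eq0P.
  - have -> : w %% u = w + u * (- (w %/ u)).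
      by rewrite {2}(divp_eq w u) mulrN mulrC addrAC subrr add0r.
    by apply: ID => //; apply: IM.
  - by rewrite -ltnS (leq_trans _ lt_un) // ltnS ltn_modp.
have [c dc] : exists c, root d c.
  apply/closed_rootP; apply/eqP => /eqP/size_poly1P[a a0 dE].
  have [q [f [q0 fx]]] := Id.
  rewrite dE -mul_polyC -polyCM => /(relation_not_constant intx fx)/eqP.
  by rewrite mulf_eq0 (negPf q0) (negPf a0).
exists c => f /I_map/dvd_d/dvdpP[w ->].
by rewrite hornerM (eqP dc) mulr0.
Qed.

End LyingOver.

(** Iterating [lying_over_root] over several elements yields specializations of
    P[Z], P[Z][Z'], and so on; P' is the last of these rings, in which all
    elements of s are represented. *)
Theorem lying_over (P W : comNzRingType) (K : closedFieldType)
    (alpha : {rmorphism P -> W}) (beta : {rmorphism P -> K}) (s : seq W) :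
  (forall p, alpha p = 0 -> beta p = 0) ->
  (forall a : K, exists p q, beta q != 0 /\ beta q * a = beta p) ->
  (forall x, x \in s -> integralOver alpha x) ->
  exists (P' : comNzRingType) (iota : {rmorphism P -> P'})
    (alpha' : {rmorphism P' -> W}) (beta' : {rmorphism P' -> K}),
    [/\ alpha' \o iota =1 alpha, beta' \o iota =1 beta,
       forall p, alpha' p = 0 -> beta' p = 0 & forall x, x \in s -> exists p, alpha' p = x].
Proof.
elim: s P alpha beta => [|x s IHs] P alpha beta le_ker beta_frac ints.
  by exists P, idfun, alpha, beta; split.
have [c cE] := lying_over_root le_ker beta_frac (ints x (mem_head _ _)).
have cax : commr_rmorph alpha x by move=> p; apply: mulrC.
have cbc : commr_rmorph beta c by move=> p; apply: mulrC.
have haC p : horner_morph cax p%:P = alpha p by apply: horner_morphC.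
have hbC p : horner_morph cbc p%:P = beta p by apply: horner_morphC.
have [p px|a|y sy|P' [iota [alpha' [beta' [aE bE le_ker' sP]]]]] :=
  IHs {poly P} (horner_morph cax) (horner_morph cbc).
- exact: cE px.
- have [p [q [q0 qE]]] := beta_frac a; exists p%:P, q%:P.
  by rewrite /= !hbC.
- have ys : y \in x :: s by rewrite inE sy orbT.
  have [F monF /eqP Fy] := ints y ys.
  exists (map_poly polyC F); first exact: monic_map.
  apply/rootP; rewrite -map_poly_comp -[RHS]Fy; congr (_.[_]); apply: eq_map_poly => p.
  exact: haC.
exists P', (iota \o polyC), alpha', beta'; split=> //.
- by move=> p /=; rewrite [LHS]aE; apply: haC.
- by move=> p /=; rewrite [LHS]bE; apply: hbC.
move=> y; rewrite inE => /predU1P[->|/sP//].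
by exists (iota 'X); rewrite [LHS]aE; apply: horner_morphX.
Qed.

(** * Minimal equations over completely integrally closed domains *)

Lemma det_exp (D : comNzRingType) n (A : 'M[D]_n.+1) j : \det (A ^+ j) = \det A ^+ j.
Proof. by elim: j => [|j IHj]; rewrite ?expr0 ?det1 // !exprS -mulmxE det_mulmx IHj. Qed.

(** An integrally closed D contains the coefficients of the minimal polynomial
    over its field of fractions of an integral element.  Complete integral
    closedness allows a proof without fractions or conjugates. *)
Section MonicRelation.
Variables (D W : idomainType) (alpha : {rmorphism D -> W}) (x : W).
Hypothesis cicDZ : completely_integrally_closed {poly D}.
Hypothesis alpha_inj : forall d, alpha d = 0 -> d = 0.
Hypothesis intx : integralOver alpha x.

Local Notation "f @x" := ((map_poly alpha f).[x]) (at level 2).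

Let atB (f g : {poly D}) : (f - g) @x = f @x - g @x.
Proof. by rewrite rmorphB hornerD hornerN. Qed.
Let atM (f g : {poly D}) : (f * g) @x = f @x * g @x.
Proof. by rewrite rmorphM hornerM. Qed.
Let atZ a (f : {poly D}) : (a *: f) @x = alpha a * f @x.
Proof. by rewrite map_polyZ hornerZ. Qed.
Let atXn n : 'X^n @x = x ^+ n.
Proof. by rewrite map_polyXn hornerXn. Qed.

Section MinimalRelation.
Variables (n : nat) (f : {poly D}).
Hypothesis fx : f @x = 0.
Hypothesis sf : size f = n.+2.
Hypothesis f_min : forall g, g @x = 0 -> g != 0 -> (n.+2 <= size g)%N.

Let a := lead_coef f.

Let a0 : a != 0.
Proof. by rewrite lead_coef_eq0 -size_poly_eq0 sf. Qed.

Lemma small_relation0 g : g @x = 0 -> (size g <= n.+1)%N -> g = 0.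
Proof.
move=> gx; apply: contraTeq => /(f_min gx).
by rewrite -ltnNge.
Qed.

(** Pseudo-division by f. *)
Lemma reduce_degree e (u : {poly D}) : (size u <= n.+1 + e)%N ->
  exists2 r : {poly D}, (size r <= n.+1)%N & alpha (a ^+ e) * u @x = r @x.
Proof.
elim: e u => [|e IHe] u su.
  by exists u; rewrite ?addn0 // in su *; rewrite expr0 rmorph1 mul1r.
pose u' := a *: u - u`_(n.+1 + e) *: ('X^e * f).
have [|r sr rE] := IHe u'.
  apply/leq_sizeP => j le_j; rewrite coefB !coefZ coefXnM ltnNge.
  have -> /= : (e <= j)%N by lia.
  have [->|ne_j] := eqVneq j (n.+1 + e)%N.
    by rewrite addnK /a lead_coefE sf mulrC subrr.
  rewrite [u`_j]nth_default ?[f`_(j - e)]nth_default ?mulr0 ?subr0 //; first by rewrite sf; lia.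
  by apply: leq_trans su _; lia.
exists r => //.
by rewrite -rE /u' atB !atZ atM fx !mulr0 subr0 exprSr rmorphM mulrA.
Qed.

Lemma powers_mx (w : 'I_n.+1 -> W) :
  (forall i, exists2 r : {poly D}, (size r <= n.+1)%N & w i = r @x) ->
  exists G : 'M[D]_n.+1, map_mx alpha G *m powers n.+1 x = \col_i w i.
Proof.
move=> /(_ _)/cid2-/all_sig2[r sr rE].
exists (\matrix_(i, j) (r i)`_j); apply/colP => i.
rewrite !mxE rE (horner_powers _ _ (sr i)).
by apply: eq_bigr => j _; rewrite !mxE.
Qed.

Lemma powers_free (G : 'M[D]_n.+1) : map_mx alpha G *m powers n.+1 x = 0 -> G = 0.
Proof.
move=> /colP G0; apply/matrixP => i j; rewrite mxE.
have := G0 i; rewrite !mxE.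
pose g := \poly_(k < n.+1) G i (inord k).
have sg : (size g <= n.+1)%N by apply: size_poly.
rewrite (eq_bigr (fun k : 'I_n.+1 => alpha g`_k * x ^+ k)); last first.
  by move=> k _; rewrite !mxE coef_poly ltn_ord inord_val.
rewrite -horner_powers // => /small_relation0/(_ sg)/(congr1 (fun p : {poly D} => p`_j)).
by rewrite coef_poly ltn_ord inord_val coef0.
Qed.

(** D[x] is generated by finitely many powers of x, so one denominator moves it
    into the span of 1, x, ..., x^n. *)
Lemma conductor : exists2 c : D, c != 0 & forall u : {poly D},
  exists2 r : {poly D}, (size r <= n.+1)%N & alpha c * u @x = r @x.
Proof.
have [F monF /eqP Fx] := intx.
exists (a ^+ size F); first exact: expf_neq0.
move=> u; have [|r sr rE] := @reduce_degree (size F) (Pdiv.Ring.rmodp u F).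
  by rewrite (leq_trans (ltnW _) (leq_addl _ _)) // Pdiv.Ring.ltn_rmodpN0 ?monic_neq0.
exists r => //; rewrite -rE; congr (_ * _).
by rewrite {1}(Pdiv.RingMonic.rdivp_eq monF u) rmorphD hornerD atM Fx mulr0 add0r.
Qed.

(** With a the leading coefficient of f, multiplication by a x is given on
    1, x, ..., x^n by a matrix C over D, and the powers of C / a have the common
    denominator c by [conductor].  Hence so do the powers of Z - C / a, and
    those of its determinant have the denominator c^(n+1).  As D[Z] is
    completely integrally closed, this determinant, which is monic of degree
    n + 1 and vanishes at x, has its coefficients in D. *)
Lemma minimal_relation_monic : exists h : {poly D},
  [/\ h \is monic, size h = n.+2 & h @x = 0].
Proof.
have [c c0 cP] := conductor.
have [C CE] : exists C : 'M[D]_n.+1,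
    map_mx alpha C *m powers n.+1 x = (alpha a * x) *: powers n.+1 x.
  have [i|C CE] := @powers_mx (fun i => alpha a * x * x ^+ i); last first.
    by exists C; rewrite CE; apply/colP => i; rewrite !mxE.
  have [|r sr rE] := @reduce_degree 1 'X^(i.+1).
    by rewrite size_polyXn addn1 ltnS.
  by exists r => //; rewrite -rE atXn expr1 exprS mulrA.
have CX j : exists G, c *: C ^+ j = a ^+ j *: G.
  have [i|G GE] := @powers_mx (fun i => alpha c * x ^+ j * x ^+ i).
    by have [r sr rE] := cP 'X^(j + i); exists r => //; rewrite -rE atXn exprD mulrA.
  exists G; apply/eqP; rewrite -subr_eq0; apply/eqP; apply: powers_free.
  have CXE : map_mx alpha (C ^+ j) *m powers n.+1 x = (alpha a * x) ^+ j *: powers n.+1 x.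
    have := eigen_horner_mx CE 'X^j.
    by rewrite rmorphXn /= horner_mx_X map_polyXn hornerXn.
  rewrite map_mxB !map_mxZ mulmxBl -!scalemxAl CXE GE; apply/colP => i; rewrite !mxE.
  by rewrite rmorphXn exprMn; ring.
pose Q : 'M[{poly D}]_n.+1 := (a *: 'X)%:M - map_mx polyC C.
have QX j : exists G, c%:P *: Q ^+ j = (a ^+ j)%:P *: G.
  have comm : GRing.comm (a *: 'X : {poly D})%:M (map_mx polyC C) by apply/esym/comm_mx_scalar.
  rewrite (exprBn_comm _ comm) scaler_sumr.
  elim/big_ind: _ => [|_ _ [z1 ->] [z2 ->]|i _]; first by exists 0; rewrite scaler0.
    by exists (z1 + z2); rewrite scalerDr.
  have [G GE] := CX i.
  have le_ij : (i <= j)%N by rewrite -ltnS.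
  exists ((((-1) ^+ i * 'X^(j - i)) *: map_mx polyC G) *+ 'C(j, i)).
  rewrite -!scalerMnr; congr (_ *+ _).
  have GE' : c%:P *: map_mx polyC C ^+ i = (a ^+ i)%:P *: map_mx polyC G.
    by rewrite -rmorphXn -!map_mxZ GE.
  have -> : (-1) ^+ i = ((-1) ^+ i)%:M :> 'M[{poly D}]_n.+1 by rewrite rmorphXn rmorphN1.
  rewrite -rmorphXn -rmorphM -mulmxE mul_scalar_mx scalerA.
  rewrite [c%:P * _]mulrC -[LHS]scalerA GE' !scalerA.
  congr (_ *: _); have -> : a ^+ j = a ^+ (j - i) * a ^+ i by rewrite -exprD subnK.
  by rewrite exprZn -mul_polyC polyCM; ring.
have detQ : \det Q = char_poly C \Po (a *: 'X).
  rewrite -[RHS]/(comp_poly _ _) -det_map_mx; congr (\det _).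
  rewrite rmorphB /= map_scalar_mx /= comp_polyX; congr (_ - _).
  by rewrite -map_mx_comp; apply/matrixP => i j; rewrite !mxE /= comp_polyC.
have aX : size (a *: 'X : {poly D}) = 2 by rewrite size_scale // size_polyX.
have lQ : lead_coef (\det Q) = a ^+ n.+1.
  rewrite detQ lead_coef_comp ?aX // (monicP (char_poly_monic C)) mul1r size_char_poly /=.
  by rewrite lead_coefZ lead_coefX mulr1.
have sQ : size (\det Q) = n.+2.
  have := size_comp_poly (char_poly C) (a *: 'X); rewrite -detQ aX size_char_poly muln1 /= => sQ.
  by rewrite -[LHS]prednK ?sQ // size_poly_gt0 -lead_coef_eq0 lQ expf_neq0.
have [h hE] : exists h, \det Q = h * (a ^+ n.+1)%:P.
  apply: (cicDZ (c := c%:P ^+ n.+1)) => [||j].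
  - by rewrite expf_neq0 // polyC_eq0.
  - by rewrite polyC_eq0 expf_neq0.
  have [G /(congr1 determinant)] := QX j.
  rewrite !detZ => QG; exists (\det G).
  by rewrite -det_exp QG !polyC_exp exprAC mulrC.
have a'0 : (a ^+ n.+1) != 0 by apply: expf_neq0.
exists h; split.
- apply/monicP/(mulIf a'0); by rewrite mul1r -[RHS]lQ hE lead_coefM lead_coefC.
- by rewrite -sQ hE mulrC mul_polyC size_scale.
have cax : commr_rmorph alpha x by move=> p; apply: mulrC.
have : horner_morph cax (\det Q) = 0.
  apply: (@det_kernel0 _ _ _ _ _ (powers n.+1 x)); last by rewrite mxE expr0.
  rewrite map_mxB mulmxBl map_scalar_mx -map_mx_comp mul_scalar_mx.
  rewrite (_ : map_mx _ C = map_mx alpha C); last first.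
    by apply/matrixP => i j; rewrite !mxE; apply: horner_morphC.
  by rewrite CE -mul_polyC rmorphM /= horner_morphC horner_morphX subrr.
rewrite hE rmorphM /= => /eqP; rewrite mulf_eq0 => /orP[/eqP//|].
by rewrite horner_morphC => /eqP/alpha_inj/eqP; rewrite (negPf a'0).
Qed.

End MinimalRelation.

Theorem monic_generator : exists h : {poly D},
  [/\ h \is monic, h @x = 0 & forall f : {poly D}, f @x = 0 -> exists g, f = g * h].
Proof.
pose rel m := `[< exists f : {poly D}, [/\ f @x = 0, f != 0 & size f = m] >].
have exrel : exists m, rel m.
  have [F monF /eqP Fx] := intx; exists (size F); apply/asboolP; exists F; split=> //.
  exact: monic_neq0.
have [m /asboolP[f [fx f0 sf]] m_min] := ex_minnP exrel.
have [n mE] : exists n, m = n.+2.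
  case: m sf m_min => [|[|n]] sf _; last by exists n.
    by move: f0; rewrite -size_poly_eq0 sf.
  have /size_poly1P[d d0 fE] : size f == 1 by rewrite sf.
  by move: fx d0; rewrite fE map_polyC hornerC => /alpha_inj->; rewrite eqxx.
have f_min g : g @x = 0 -> g != 0 -> (n.+2 <= size g)%N.
  by move=> gx g0; rewrite -mE; apply: m_min; apply/asboolP; exists g.
rewrite mE in sf.
have [h [monh sh hx]] := minimal_relation_monic fx sf f_min.
exists h; split=> // g gx; exists (Pdiv.Ring.rdivp g h).
rewrite {1}(Pdiv.RingMonic.rdivp_eq monh g).
rewrite (small_relation0 f_min (g := Pdiv.Ring.rmodp g h)) ?addr0 //.
  have := congr1 (fun p => p @x) (Pdiv.RingMonic.rdivp_eq monh g).
  by rewrite /= rmorphD hornerD atM hx mulr0 add0r gx.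
by rewrite -ltnS -sh Pdiv.Ring.ltn_rmodpN0 // monic_neq0.
Qed.

End MonicRelation.

(** * Evaluation of polynomials in several variables *)

Section PolynomialMaps.
Variables (n : nat) (V : comNzRingType).

Lemma mmap1_rmorph (S S' : comNzRingType) (phi : {rmorphism S -> S'}) (h : 'I_n -> S) m :
  phi (mmap1 h m) = mmap1 (phi \o h) m.
Proof. by rewrite /mmap1 rmorph_prod; apply: eq_bigr => i _; rewrite rmorphXn. Qed.

Lemma mmap_rmorph (S S' : comNzRingType) (phi : {rmorphism S -> S'}) (f : V -> S)
  (h : 'I_n -> S) (p : {mpoly V[n]}) : phi (mmap f h p) = mmap (phi \o f) (phi \o h) p.
Proof.
by rewrite /mmap rmorph_sum; apply: eq_bigr => m _; rewrite rmorphM mmap1_rmorph.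
Qed.

Lemma eq_mmap (S : comNzRingType) (f f' : V -> S) (h h' : 'I_n -> S) (p : {mpoly V[n]}) :
  f =1 f' -> h =1 h' -> mmap f h p = mmap f' h' p.
Proof.
move=> ef eh; apply: eq_bigr => m _; rewrite ef; congr (_ * _).
by apply: eq_bigr => i _; rewrite eh.
Qed.

Lemma mmap1_scale (S : comNzRingType) (c : S) (h : 'I_n -> S) m :
  mmap1 (fun i => c * h i) m = c ^+ mdeg m * mmap1 h m.
Proof.
rewrite mdegE -prodrXr -big_split; apply: eq_bigr => i _ /=.
by rewrite exprMn.
Qed.

Lemma mmap_homog_scale (S : comNzRingType) (f : V -> S) (c : S) (h : 'I_n -> S) d
  (p : {mpoly V[n]}) : p \is d.-homog ->
  mmap f (fun i => c * h i) p = c ^+ d * mmap f h p.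
Proof.
move=> /dhomogP homp; rewrite /mmap mulr_sumr; apply: eq_big_seq => m /homp <-.
by rewrite mmap1_scale mulrCA.
Qed.

(** Relations between the coordinates of a cone are homogeneous: in degree d the
    relation f restricts to its homogeneous part. *)
Lemma coef_mmap_cone (A : comNzRingType) (f : {rmorphism V -> A}) (a : 'I_n -> A) d
  (p : {mpoly V[n]}) :
  (mmap (polyC \o f) (fun i => 'X * (a i)%:P) p)`_d = mmap f a (pihomog mdeg d p).
Proof.
rewrite /mmap coef_sum pihomogE -/(mmap f a _) raddf_sum [RHS]big_mkcond /=.
apply: eq_bigr => m _; rewrite mmap1_scale -[mmap1 _ m]/(mmap1 (polyC \o a) m).
rewrite -mmap1_rmorph coefCM coefMC coefXn eq_sym mmapZ mmapX.
by case: eqP; rewrite ?mul1r // mul0r mulr0.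
Qed.

Lemma size_mmap_linear (C : comNzRingType) (f : {rmorphism V -> C}) (h : 'I_n -> {poly C}) d
  (p : {mpoly V[n]}) : p \is d.-homog -> (forall i, (size (h i) <= 2)%N) ->
  (size (mmap (polyC \o f) h p) <= d.+1)%N /\
  (mmap (polyC \o f) h p)`_d = mmap f (fun i => (h i)`_1) p.
Proof.
move=> /dhomogP homp sh.
pose T e (q : {poly C}) c := (size q <= e.+1)%N /\ q`_e = c.
have TM e e' q q' c c' : T e q c -> T e' q' c' -> T (e + e')%N (q * q') (c * c').
  move=> [sq <-] [sq' <-]; split.
    by apply: leq_trans (size_polyMleq _ _) _; lia.
  rewrite coefM (bigD1 (Ordinal (leq_addr e' e : (e < (e + e').+1)%N))) //= addKn big1 ?addr0 //.
  move=> i; rewrite -val_eqE /= => ne_ie.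
  have [lt_ie|le_ei] := ltnP i e.
    by rewrite [q'`_ _]nth_default ?mulr0 // (leq_trans sq') //; lia.
  by rewrite [q`_ _]nth_default ?mul0r // (leq_trans sq) //; lia.
have TX m : T (mdeg m) (mmap1 h m) (mmap1 (fun i => (h i)`_1) m).
  rewrite mdegE /mmap1.
  elim/big_ind3: _ => [|e q c e' q' c' /TM TqM /TqM//|i _].
    by split; rewrite ?size_poly1 ?coef1.
  elim: (m i) => [|e IHe]; first by split; rewrite ?expr0 ?size_poly1 ?coef1.
  by rewrite !exprS -add1n; apply: TM.
suff : T d (mmap (polyC \o f) h p) (mmap f (fun i => (h i)`_1) p) by [].
rewrite /mmap big_seq [X in T _ _ X]big_seq.
elim/big_ind2: _ => [|q c q' c' [sq <-] [sq' <-]|m /homp mE].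
- by split; rewrite ?size_poly0 ?coef0.
- by split; rewrite ?coefD // (leq_trans (size_polyD _ _)) // geq_max sq.
rewrite -[d]add0n -mE; apply: TM; last exact: TX.
by split=> /=; [rewrite size_polyC; case: eqP|rewrite coefC].
Qed.

Lemma integral_mmap (B S : comNzRingType) (alpha : {rmorphism B -> S}) (f : V -> S)
  (h : 'I_n -> S) (p : {mpoly V[n]}) :
  (forall c, integralOver alpha (f c)) -> (forall i, integralOver alpha (h i)) ->
  integralOver alpha (mmap f h p).
Proof.
move=> intf inth; rewrite /mmap.
elim/big_ind: _ => [|x y|m _]; [exact: integral0|exact: integral_add|].
apply: integral_mul => //; rewrite /mmap1.
elim/big_ind: _ => [|x y|i _]; [exact: integral1|exact: integral_mul|].
by elim: (m i) => [|e IHe]; rewrite ?expr0 ?exprS; [exact: integral1|exact: integral_mul].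
Qed.

End PolynomialMaps.

Definition inexhaustible (T : eqType) (S : T -> Prop) :=
  forall s : seq T, exists2 x, S x & x \notin s.

Lemma poly_nonroot (B : idomainType) (S : B -> Prop) (p : {poly B}) :
  inexhaustible S -> p != 0 -> exists2 x, S x & ~~ root p x.
Proof.
move=> infS p0; apply: contrapT => noroot.
have allroot x : S x -> root p x by move=> Sx; apply: contra_notT noroot => ?; exists x.
have [s [us ss rs]] : exists s, [/\ uniq s, size s = size p & all (root p) s].
  elim: (size p) => [|m [s [us ss rs]]]; first by exists [::].
  have [x Sx xs] := infS s; exists (x :: s); split=> /=; first by rewrite xs.
    by rewrite ss.
  by rewrite allroot.
by have := max_poly_roots p0 rs us; rewrite ss ltnn.
Qed.

(** The variables are replaced by constants one after the other: at each step p
    is a nonzero polynomial in the next variable over a domain, so all but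
    finitely many constants keep it nonzero. *)
Theorem mpoly_nonroot (B : idomainType) n (S : 'I_n -> B -> Prop) (p : {mpoly B[n]}) :
  (forall i, inexhaustible (S i)) -> p != 0 ->
  exists2 s : 'I_n -> B, forall i, S i (s i) & p.@[s] != 0.
Proof.
move=> infS p0.
have specialize l : (l <= n)%N -> exists z : 'I_n -> {mpoly B[n]},
    (forall i : 'I_n, if (i < l)%N then exists2 c, S i c & z i = c%:MP else z i = 'X_i) /\
    mmap (@mpolyC n B) z p != 0.
  elim: l => [|l IHl] lt_ln.
    exists (fun i => 'X_i); split=> //.
    rewrite [X in X != 0](_ : _ = p) // [RHS]mpolyE; apply: eq_bigr => m _.
    by rewrite mmap1_id mul_mpolyC.
  have [z [zS zp]] := IHl (ltnW lt_ln).
  pose i0 := Ordinal lt_ln.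
  pose q := mmap (polyC \o @mpolyC n B) (fun i => if i == i0 then 'X else (z i)%:P) p.
  have qE (c : {mpoly B[n]}) : q.[c] = mmap (@mpolyC n B) (fun i => if i == i0 then c else z i) p.
    rewrite /q -[LHS]/(horner_eval c _) mmap_rmorph; apply: eq_mmap => [b|i] /=.
      by rewrite /horner_eval hornerC.
    by rewrite /horner_eval; case: eqP; rewrite ?hornerX ?hornerC.
  have q0 : q != 0.
    apply: contra_neq zp => q0; have := qE (z i0); rewrite q0 horner0 => ->.
    by apply: eq_mmap => // i; case: eqP => [->|].
  have [|_ [c Sc <-] /negP qc] := @poly_nonroot _ (fun x => exists2 c, S i0 c & c%:MP = x) q _ q0.
    move=> s; have [c Sc cs] := infS i0 [seq f@_0%MM | f <- s].
    exists c%:MP; first by exists c.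
    by apply: contra cs => cs; apply/mapP; exists c%:MP; rewrite // mcoeffC eqxx mulr1.
  exists (fun i => if i == i0 then c%:MP else z i); split; last first.
    by apply: contra_notN qc => /eqP qc; rewrite /root qE qc.
  move=> i; have := zS i; rewrite ltnS [(i <= l)%N]leq_eqVlt -val_eqE /=.
  case: eqP => [il|_] /=; last by [].
  by have -> : i = i0 by [apply: val_inj]; move=> _; exists c.
have [z [zS zp]] := specialize n (leqnn n).
have {zS} /choice[s sP] : forall i, exists c, S i c /\ z i = c%:MP.
  by move=> i; have := zS i; rewrite ltn_ord => -[c]; exists c.
exists s => [i|]; first by case: (sP i).
apply: contra_neq zp => ps.
rewrite (@eq_mmap _ _ _ _ (@mpolyC n B \o idfun) _ (@mpolyC n B \o s)) => [|//|i].
  by rewrite -mmap_rmorph -/(meval s p) ps rmorph0.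
by case: (sP i).
Qed.

(** * Valuation rings of algebraically closed fields *)

(** V is a valuation ring of K with residue field k, not a field and of rank
    one; the latter is expressed by [vr_cic], and [vr_unit] says that the kernel
    of [rho] consists of the nonunits. *)
Record is_valuation_ring (V : idomainType) (K k : fieldType)
    (iota : {rmorphism V -> K}) (rho : {rmorphism V -> k}) : Prop := IsValuationRing {
  vr_inj : forall a, iota a = 0 -> a = 0;
  vr_total : forall a b : V, (exists z, a = z * b) \/ (exists z, b = z * a);
  vr_frac : forall x : K, exists p q : V, iota q != 0 /\ iota q * x = iota p;
  vr_unit : forall a, rho a != 0 -> exists b, a * b = 1;
  vr_surj : forall x, exists a, rho a = x;
  vr_cic : completely_integrally_closed V;
  vr_nontrivial : exists2 a : V, a != 0 & rho a = 0
}.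

Section ValuationRing.
Variables (V : idomainType) (K : closedFieldType) (k : fieldType).
Variables (iota : {rmorphism V -> K}) (rho : {rmorphism V -> k}).
Hypothesis VR : is_valuation_ring iota rho.

Lemma vr_iota_inj : injective iota.
Proof.
move=> a b ab; apply/eqP; rewrite -subr_eq0; apply/eqP; apply: (vr_inj VR).
by rewrite rmorphB ab subrr.
Qed.

(** If z = 1 / x is in V, dividing the equation by x^(deg G - 1) expresses x as a
    polynomial in z. *)
Lemma vr_integrally_closed (G : {poly V}) (x : K) :
  G \is monic -> root (map_poly iota G) x -> exists v, iota v = x.
Proof.
move=> monG /eqP Gx; have [p [q [q0 qx]]] := vr_frac VR x.
have q'0 : q != 0 by apply: contra_neq q0 => ->; rewrite rmorph0.
have [[z pE]|[z qE]] := vr_total VR p q.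
  by exists z; apply: (mulfI q0); rewrite qx pE rmorphM mulrC.
have [n sG] : exists n, size G = n.+2.
  case sG: (size G) => [|[|n]]; last by exists n.
    by have := monic_neq0 monG; rewrite -size_poly_eq0 sG.
  have G0 : G = (G`_0)%:P by apply: size1_polyC; rewrite sG.
  move/monicP: monG; rewrite lead_coefE sG => G1; move/eqP: Gx.
  by rewrite G0 G1 rmorph1 hornerC oner_eq0.
have zx : iota z * x = 1.
  have p0 : iota p != 0 by apply: contra_neq q0; rewrite qE rmorphM => ->; rewrite mulr0.
  by apply: (mulfI p0); rewrite mulr1 mulrA -rmorphM [p * z]mulrC -qE qx.
exists (- \sum_(i < n.+1) G`_i * z ^+ (n - i)).
have lG : iota G`_n.+1 = 1.
  by rewrite -(rmorph1 iota); congr (iota _); move/monicP: monG; rewrite lead_coefE sG.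
have {}Gx : x ^+ n.+1 = - \sum_(i < n.+1) iota G`_i * x ^+ i.
  move: Gx; rewrite (@horner_coef_wide _ n.+2) ?size_poly ?sG //; last first.
    by rewrite -sG size_poly.
  rewrite big_ord_recr /= coef_map /= lG mul1r => /eqP.
  by rewrite addrC addr_eq0 => /eqP ->; congr (- _); apply: eq_bigr => i _; rewrite coef_map.
have -> : x = iota z ^+ n * x ^+ n.+1.
  by rewrite exprSr mulrA -exprMn zx expr1n mul1r.
rewrite Gx mulrN mulr_sumr rmorphN rmorph_sum; congr (- _); apply: eq_bigr => i _.
rewrite rmorphM rmorphXn mulrCA; congr (_ * _).
have le_in : (i <= n)%N by rewrite -ltnS.
have -> : iota z ^+ n = iota z ^+ (n - i) * iota z ^+ i by rewrite -exprD subnK.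
by rewrite -mulrA -exprMn zx expr1n mulr1.
Qed.

Lemma vr_split (G : {poly V}) : G \is monic ->
  exists s : seq V, G = \prod_(z <- s) ('X - z%:P).
Proof.
move=> monG; have [r rE] := closed_field_poly_normal (map_poly iota G).
have [s sE] : exists s, r = map iota s.
  have : {in r, forall x, exists v, iota v = x}.
    move=> x xr; apply: (vr_integrally_closed monG); rewrite rE.
    rewrite rootZ ?lead_coef_eq0 ?root_prod_XsubC //.
    by rewrite monic_neq0 // monic_map.
  elim: r {rE} => [|x r IHr] rV; first by exists [::].
  have [y yr|s ->] := IHr; first by apply: rV; rewrite inE yr orbT.
  by have [v <-] := rV x (mem_head _ _); exists (v :: s).
exists s; apply: (map_inj_poly vr_iota_inj (rmorph0 _)).
rewrite rE (monicP _) ?monic_map // scale1r sE big_map rmorph_prod.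
by apply: eq_bigr => z _; rewrite /= map_polyXsubC.
Qed.

(** K is algebraically closed, so lifting Euclid's argument works: a root of
    1 + prod_z (Z - z) has a residue different from those of all z. *)
Lemma vr_residue_inexhaustible : inexhaustible (fun _ : k => True).
Proof.
move=> s; suff [x xs] : exists x, x \notin s by exists x.
have [t tE] : exists t, s = map rho t.
  elim: s => [|x s [t ->]]; first by exists [::].
  by have [v <-] := vr_surj VR x; exists (v :: t).
have [->|s0] := eqVneq s [::]; first by exists 0.
pose G := \prod_(z <- t) ('X - z%:P) + 1.
have st : (0 < size t)%N by rewrite -(size_map rho) -tE lt0n size_eq0.
have sG : size G = (size t).+1.
  by rewrite size_polyDl size_prod_XsubC // size_poly1 ltnS.
have monG : G \is monic.
  rewrite monicE lead_coefDl ?size_prod_XsubC ?size_poly1 ?ltnS //.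
  by have := monic_prod_XsubC t xpredT id; rewrite monicE.
have [[|r r'] GE] := vr_split monG.
  by move: sG; rewrite GE big_nil size_poly1 => -[tE']; rewrite -tE' in st.
exists (rho r); rewrite tE; apply: contraT; rewrite negbK => /mapP[z zt rz].
have := congr1 (fun p => rho p.[r]) GE.
rewrite big_cons hornerM hornerXsubC subrr mul0r rmorph0.
rewrite hornerD hornerC rmorphD rmorph1 horner_prod rmorph_prod (big_rem z) //=.
by rewrite hornerXsubC rmorphB rz subrr mul0r add0r => /eqP; rewrite oner_eq0.
Qed.

(** The elements a + p w, with p nonzero of residue 0, are as many as the
    residues of w. *)
Lemma vr_coset_inexhaustible (a : V) :
  inexhaustible (fun x : V => rho x = rho a).
Proof.
move=> s; have [p p0 rp] := vr_nontrivial VR.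
have [x _ xP] := vr_residue_inexhaustible
  [seq rho (xget 0 [set w | z = a + p * w]%classic) | z <- s].
have [w wE] := vr_surj VR x; exists (a + p * w).
  by rewrite rmorphD rmorphM rp mul0r addr0.
apply: contra xP => xs; apply/mapP; exists (a + p * w) => //.
rewrite -wE; congr (rho _); case: xgetP => [w' _ /= /addrI/(mulfI p0)//|].
by move=> /(_ w)[].
Qed.

End ValuationRing.

(** * Projective Noether normalization over a valuation ring *)

Section Normalization.
Variables (V : idomainType) (K : closedFieldType) (k : fieldType).
Variables (iota : {rmorphism V -> K}) (rho : {rmorphism V -> k}).
Hypothesis VR : is_valuation_ring iota rho.

Lemma primitive_part n (g : {mpoly V[n]}) : g != 0 ->
  exists c g', g = c *: g' /\ exists m, g'@_m = 1.
Proof.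
move=> g0; have [m [mg m_min]] : exists m, m \in msupp g /\
    forall m', m' \in msupp g -> exists z, g@_m' = z * g@_m.
  have : msupp g != [::] by rewrite msupp_eq0.
  elim: (msupp g) => // m [|m1 s] IHs _.
    exists m; rewrite mem_head; split=> // m'; rewrite inE => /eqP->.
    by exists 1; rewrite mul1r.
  have [//|m2 [m2s m2_min]] := IHs.
  have [[z zE]|[z zE]] := vr_total VR g@_m g@_m2.
    exists m2; split; first by rewrite inE m2s orbT.
    by move=> m'; rewrite inE => /predU1P[->|/m2_min//]; exists z.
  exists m; rewrite mem_head; split=> // m'; rewrite inE => /predU1P[->|/m2_min[y ->]].
    by exists 1; rewrite mul1r.
  by exists (y * z); rewrite zE mulrA.
have /choice[z zE] : forall m', exists z, g@_m' = z * g@_m.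
  move=> m'; have [/m_min//|/memN_msupp_eq0 ->] := boolP (m' \in msupp g).
  by exists 0; rewrite mul0r.
have gE : g = g@_m *: \sum_(m' <- msupp g) z m' *: 'X_[m'].
  rewrite {1}[g]mpolyE scaler_sumr; apply: eq_bigr => m' _.
  by rewrite scalerA mulrC -zE.
exists g@_m, (\sum_(m' <- msupp g) z m' *: 'X_[m']); split=> //.
have gm0 : g@_m != 0 by rewrite -mcoeff_msupp.
exists m; apply: (mulfI gm0).
by rewrite mulr1 -[LHS](mcoeffZ _ _ m) -gE.
Qed.

Variables (A : idomainType) (j : {rmorphism V -> A}).
Hypothesis j_inj : forall a, j a = 0 -> a = 0.

Local Notation cone a := (mmap (polyC \o j) (fun i => 'X * (a i)%:P)).

Lemma primitive_homogeneous_relation n (a : 'I_n -> A) (f : {mpoly V[n]}) :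
  cone a f = 0 -> f != 0 ->
  exists d (g : {mpoly V[n]}), [/\ g \is d.-homog, cone a g = 0 & exists m, g@_m = 1].
Proof.
move=> fa f0.
have [d fd0] : exists d, pihomog mdeg d f != 0.
  apply: contrapT => /forallNP fd0; move/eqP: f0; apply.
  rewrite (pihomog_partitionE (leqnn (mmeasure mdeg f))) big1 // => d _.
  by apply/eqP; apply: contra_notT (fd0 d).
have [c [g [gE [m gm]]]] := primitive_part fd0.
have c0 : c != 0 by apply: contra_neq fd0 => c0; rewrite gE c0 scale0r.
have homg : g \is d.-homog.
  apply/dhomogP => m'; rewrite mcoeff_msupp => gm'.
  have /dhomogP := pihomogP mdeg d f; apply.
  by rewrite mcoeff_msupp gE mcoeffZ mulf_neq0.
exists d, g; split=> //; last by exists m.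
rewrite (mmap_homog_scale _ _ _ homg).
suff -> : mmap (polyC \o j) (polyC \o a) g = 0 by rewrite mulr0.
rewrite -mmap_rmorph -[RHS](rmorph0 polyC); congr (_%:P).
have := coef_mmap_cone j a d f; rewrite fa coef0 gE mmapZ => /esym/eqP.
by rewrite mulf_eq0 => /orP[/eqP/j_inj/eqP|/eqP //]; rewrite (negPf c0).
Qed.

(** If the coordinates x_i = Z a_i are not independent, they satisfy a
    homogeneous equation g with a unit coefficient, so g(s) is a unit for some
    s, and s_0 can be assumed to be a unit as well.  With r = s / s_0, the
    equation becomes monic in x_0, up to a unit, when rewritten in terms of the
    x_i - r_i x_0 with i > 0.  These are again coordinates of a cone, one fewer,
    to which the induction applies. *)
Theorem noether_normalization n (a : 'I_n -> A) :
  exists d (b : 'I_d -> A),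
  [/\ forall l, exists c : 'I_n -> V, b l = \sum_i j (c i) * a i,
      forall f : {mpoly V[d]}, cone b f = 0 -> f = 0
    & forall i, integralOver (cone b) ('X * (a i)%:P)].
Proof.
elim: n a => [|n IHn] a.
  exists 0%N, a; split=> [[]//|f|[]//].
  by rewrite (nvar0_mpolyC f) mmapC => /polyC_inj/j_inj->.
have [indep|] := pselect (forall f : {mpoly V[n.+1]}, cone a f = 0 -> f = 0).
  exists n.+1, a; split=> // [l|i].
    exists (fun i => (i == l)%:R); rewrite (bigD1 l) //= eqxx rmorph1 mul1r.
    by rewrite big1 ?addr0 // => i /negPf->; rewrite rmorph0 mul0r.
  have : integralOver (cone a) (cone a 'X_i) by apply: integral_id.
  by rewrite mmapX mmap1U.
move=> /existsNP[f /not_implyP[fa /eqP f0]].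
have [D [g [homg ga [m gm]]]] := primitive_homogeneous_relation fa f0.
have [s s0 gs] : exists2 s : 'I_n.+1 -> V, rho (s ord0) != 0 & rho g.@[s] != 0.
  pose g' := map_mpoly rho g * 'X_ord0.
  have g'0 : g' != 0.
    rewrite mulf_neq0 //; last by rewrite -msupp_eq0 msuppX.
    by apply/eqP => /mpolyP/(_ m)/eqP; rewrite mcoeff_map_mpoly /= gm rmorph1 mcoeff0 oner_eq0.
  have [t _] := mpoly_nonroot (fun i => vr_residue_inexhaustible VR) g'0.
  have /choice[s sE] : forall i, exists c, rho c = t i by move=> i; apply: vr_surj VR _.
  rewrite mevalM mevalXU mulf_eq0 negb_or => /andP[gt t0].
  exists s; rewrite ?sE //; apply: contra gt => /eqP <-; apply/eqP.
  rewrite /meval mmap_rmorph /map_mpoly mmap_rmorph; apply: eq_mmap => [c|i] /=.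
    by rewrite -/(meval t _) mevalC.
  by rewrite -/(meval t _) mevalXU sE.
have [u su] := vr_unit VR s0.
pose r i := u * s i.
have r0 : r ord0 = 1 by rewrite /r mulrC su.
have [w wr] : exists w, w * g.@[r] = 1.
  have [w' w'E] := vr_unit VR gs.
  exists (w' * s ord0 ^+ D).
  rewrite /meval (mmap_homog_scale _ _ _ homg) -/(meval s g).
  have suD : s ord0 ^+ D * u ^+ D = 1 by rewrite -exprMn su expr1n.
  by rewrite mulrA -(mulrA w') suD mulr1 mulrC w'E.
pose b l := a (lift ord0 l) - j (r (lift ord0 l)) * a ord0.
have [d [b' [b'_span b'_free b'_int]]] := IHn b.
exists d, b'; split=> //.
  move=> l; have [c ->] := b'_span l.
  exists (fun i => if unlift ord0 i is Some i' then c i' else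
    - \sum_i' c i' * r (lift ord0 i')).
  rewrite big_ord_recl unlift_none /= rmorphN rmorph_sum mulNr mulr_suml.
  rewrite addrC -sumrB; apply: eq_bigr => i _.
  by rewrite liftK rmorphM /b; ring.
have intC c : integralOver (cone b') (polyC (j c)).
  have : integralOver (cone b') (cone b' c%:MP) by apply: integral_id.
  by rewrite mmapC.
(* the substitution x_i = (x_i - r_i x_0) + r_i x_0, in the variable 'X = x_0 *)
pose h (i : 'I_n.+1) : {poly {mpoly V[n]}} :=
  if unlift ord0 i is Some i' then ('X_i')%:P + (r i)%:MP *: 'X else 'X.
have [sG GD] : (size (mmap (polyC \o @mpolyC n V) h g) <= D.+1)%N /\
  (mmap (polyC \o @mpolyC n V) h g)`_D = (g.@[r])%:MP.
  have [i|sG ->] := size_mmap_linear (@mpolyC n V) homg (h := h).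
    rewrite /h; case: unliftP => [i' _|_]; rewrite ?size_polyX //.
    rewrite (leq_trans (size_polyD _ _)) // geq_max size_polyC.
    by rewrite (leq_trans (size_scale_leq _ _)) ?size_polyX //; case: eqP.
  split=> //; rewrite /meval mmap_rmorph; apply: eq_mmap => // i /=.
  rewrite /h; case: unliftP => [i' _|->]; last by rewrite coefX r0 mpolyC1.
  by rewrite coefD coefC coefZ coefX /= add0r mulr1.
set G := mmap _ h g in sG GD.
have Ga : (map_poly (cone b) G).['X * (a ord0)%:P] = 0.
  have com : commr_rmorph (cone b) ('X * (a ord0)%:P) by move=> c; apply: mulrC.
  rewrite -[LHS]/(horner_morph com G) /G mmap_rmorph -[RHS]ga.
  apply: eq_mmap => [c|i] /=; first by rewrite horner_morphC /= mmapC.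
  rewrite /h; case: unliftP => [i' ->|->]; last exact: horner_morphX.
  rewrite rmorphD -mul_polyC rmorphM /= !horner_morphC horner_morphX /= mmapX mmap1U mmapC /=.
  by rewrite /b polyCB polyCM; ring.
have inta0 : integralOver (cone b') ('X * (a ord0)%:P).
  apply: (@integral_root_monic _ _ _ _ (map_poly (cone b) (w%:MP *: G))).
  - apply: monic_map; apply/monicP; rewrite lead_coefE.
    have p1 : (w%:MP *: G)`_D = 1 by rewrite coefZ GD -mpolyCM wr.
    have -> : size (w%:MP *: G) = D.+1; last by [].
    apply/eqP; rewrite eqn_leq (leq_trans (size_scale_leq _ _)) //=.
    by rewrite ltnNge; apply/negP => /leq_sizeP/(_ D (leqnn _))/eqP; rewrite p1 oner_eq0.
  - by apply/rootP; rewrite map_polyZ hornerZ Ga mulr0.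
  - apply/integral_poly => i; rewrite coef_map /=.
    by apply: integral_mmap => // c; apply: intC.
move=> i; case: (unliftP ord0 i) => [i'|] -> //.
have -> : 'X * (a (lift ord0 i'))%:P =
   'X * (b i')%:P + (j (r (lift ord0 i')))%:P * ('X * (a ord0)%:P).
  by rewrite /b polyCB polyCM; ring.
apply: integral_add => //; apply: integral_mul => //.
Qed.

End Normalization.

(** * Lifting residue points *)

Lemma integral_nonzero_constant (D W : idomainType) (alpha : {rmorphism D -> W}) (x : W) :
  x != 0 -> integralOver alpha x ->
  exists F : {poly D}, [/\ F \is monic, root (map_poly alpha F) x & F`_0 != 0].
Proof.
move=> x0 [F monF Fx]; have [n] := ubnP (size F).
elim: n F monF Fx => // n IHn F monF Fx sF.
have [F0|] := eqVneq F`_0 0; last by exists F.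
have [F' FE] : exists F', F = F' * 'X.
  have : root F 0 by rewrite /root horner_coef0 F0.
  by move/factor_theorem => [F' ->]; exists F'; rewrite subr0.
have monF' : F' \is monic by move: monF; rewrite FE monicMr // monicX.
apply: (IHn F') => //.
  by move: Fx; rewrite FE rmorphM rootM /= map_polyX rootX (negPf x0) orbF.
by move: sF; rewrite FE size_mulX // monic_neq0.
Qed.

(** There are finitely many candidates c.  Each one whose residue differs from
    that of r gives a nonzero polynomial sum_i rho (c_i - r_i) X^i over k, and s
    is taken above a common nonroot of these. *)
Lemma separating_powers (V : comNzRingType) (k : idomainType) (rho : {rmorphism V -> k}) n
    (L : 'I_n -> seq V) (r : 'I_n -> V) :
  (forall x, exists a, rho a = x) -> inexhaustible (fun _ : k => True) ->
  exists s : V, forall c : 'I_n -> V, (forall i, c i \in L i) ->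
    rho (\sum_(i < n) s ^+ i * c i) = rho (\sum_(i < n) s ^+ i * r i) ->
    forall i, rho (c i) = rho (r i).
Proof.
move=> rho_surj infk.
pose Lall := flatten [seq L i | i : 'I_n].
pose q (w : 'I_n -> V) : {poly k} := \sum_(i < n) (rho (w i - r i))%:P * 'X^i.
have qcoef w (i : 'I_n) : (q w)`_i = rho (w i - r i).
  rewrite /q coef_sum (bigD1 i) //= coefCM coefXn eqxx mulr1 big1 ?addr0 // => i' ne.
  by rewrite coefCM coefXn val_eqE eq_sym (negPf ne) mulr0.
pose Q := \prod_(w : {ffun 'I_n -> seq_sub Lall} | q (val \o w) != 0) q (val \o w).
have Q0 : Q != 0 by apply/prodf_neq0.
have [x _ Qx] := poly_nonroot infk Q0.
have [s sE] := rho_surj x; exists s => c cL cE i.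
have cLall i' : c i' \in Lall.
  by apply/flattenP; exists (L i') => //; apply: map_f; rewrite mem_enum.
pose w := [ffun i' => SeqSub (cLall i')].
have wE : val \o w =1 c by move=> i'; rewrite /= ffunE.
have qx : (q (val \o w)).[x] = 0.
  rewrite /q horner_sum -[RHS](subrr (rho (\sum_(i < n) s ^+ i * r i))) -{1}cE.
  rewrite -rmorphB -sumrB rmorph_sum; apply: eq_bigr => i' _.
  by rewrite hornerM hornerC hornerXn -sE (wE i') -mulrBr rmorphM rmorphXn mulrC.
have : q (val \o w) = 0.
  apply: contraNeq Qx => q0; rewrite /Q (bigD1 w) //= rootM.
  by rewrite /root qx eqxx.
move/(congr1 (fun p : {poly k} => p`_i)).
by rewrite qcoef coef0 (wE i) rmorphB => /eqP; rewrite subr_eq0 => /eqP.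
Qed.

Section Lifting.
Variables (V : idomainType) (K : closedFieldType) (k : fieldType).
Variables (iota : {rmorphism V -> K}) (rho : {rmorphism V -> k}).
Hypothesis VR : is_valuation_ring iota rho.
Variables (A : idomainType) (j : {rmorphism V -> A}).
Hypothesis j_inj : forall a, j a = 0 -> a = 0.

Local Notation cone a := (mmap (polyC \o j) (fun i => 'X * (a i)%:P)).

(** Going down along D = V[y] -> A[Z] followed by the evaluation of the
    x_i = Z a_i; the points are constructed as specializations of D[theta],
    where theta = sum_i s^i x_i. *)
Theorem lift_residue_point n (a : 'I_n -> A) (r : 'I_n -> V) (G : {mpoly V[n]}) :
  (forall f : {mpoly V[n]}, cone a f = 0 -> rho f.@[r] = 0) -> cone a G != 0 ->
  exists c : 'I_n -> V, [/\ forall i, rho (c i) = rho (r i),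
    forall f : {mpoly V[n]}, cone a f = 0 -> f.@[c] = 0 & G.@[c] != 0].
Proof.
move=> relr Ga0.
have [d [b [/choice[l bE] b_free int_a]]] := noether_normalization VR j_inj a.
have intC c : integralOver (cone b) (j c)%:P.
  have : integralOver (cone b) (cone b c%:MP) by apply: integral_id.
  by rewrite mmapC.
have int_cone f : integralOver (cone b) (cone a f) by apply: integral_mmap.
have /choice[F FP] : forall i, exists F, F \is monic /\ root (map_poly (cone b) F) ('X * (a i)%:P).
  by move=> i; have [F] := int_a i; exists F.
(* G stays nonzero at c as soon as FG`_0 is nonzero at y *)
have [FG [monFG FGa FG0]] := integral_nonzero_constant Ga0 (int_cone G).
pose eta t := \sum_i l t i * r i.
have [y yE FGy] := mpoly_nonroot (fun t => vr_coset_inexhaustible VR (eta t)) FG0.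
have /choice[L LE] : forall i, exists s : seq V,
    map_poly (meval y) (F i) = \prod_(z <- s) ('X - z%:P).
  by move=> i; apply: (vr_split VR); apply: monic_map; case: (FP i).
(* L i contains the possible values of the i-th coordinate, whatever s is *)
have [s sP] := separating_powers L r (vr_surj VR) (vr_residue_inexhaustible VR).
pose Th : {mpoly V[n]} := \sum_(i < n) s ^+ i *: 'X_i.
have Th_at (c : 'I_n -> V) : Th.@[c] = \sum_(i < n) s ^+ i * c i.
  by rewrite raddf_sum; apply: eq_bigr => i _ /=; rewrite mevalZ mevalXU.
have [h [monh hTh h_gen]] :=
  monic_generator (cic_poly (cic_mpoly (vr_cic VR))) b_free (int_cone Th).
have [t ht tE] : exists2 t, root (map_poly (meval y) h) t & rho t = rho Th.@[r].
  (* h(theta) = 0 is a relation between the x_i, so it holds at r modulo the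
     maximal ideal; and y has the residue of the image of r *)
  pose pull : {mpoly V[d]} -> {mpoly V[n]} :=
    mmap (@mpolyC n V) (fun t => \sum_(i < n) l t i *: 'X_i).
  have cone_pull p : cone a (pull p) = cone b p.
    rewrite /pull mmap_rmorph; apply: eq_mmap => [c|t] /=; first by rewrite mmapC.
    rewrite bE raddf_sum [RHS](_ : _ = \sum_(i < n) 'X * (j (l t i) * a i)%:P).
      by apply: eq_bigr => i _; rewrite /= mmapZ mmapX mmap1U polyCM mulrCA.
    by rewrite rmorph_sum mulr_sumr.
  have pull_r p : rho (pull p).@[r] = rho p.@[y].
    rewrite /pull /meval !mmap_rmorph; apply: eq_mmap => [c|t] /=.
      by rewrite mmapC.
    rewrite yE /eta raddf_sum rmorph_sum; apply: eq_bigr => i _.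
    by rewrite /= mmapZ mmapX mmap1U rmorphM.
  have /relr : cone a
      (map_poly (mmap (@mpolyC n V) (fun t => \sum_(i < n) l t i *: 'X_i)) h).[Th] = 0.
    rewrite -horner_map -map_poly_comp -[RHS]hTh; congr (_.[_]).
    by apply: eq_map_poly => p; apply: cone_pull.
  have [ts tsE] : exists ts, map_poly (meval y) h = \prod_(z <- ts) ('X - z%:P).
    by apply: (vr_split VR); apply: monic_map.
  rewrite -!horner_map -!map_poly_comp.
  rewrite (@eq_map_poly _ _ _ (rho \o meval y)) => [|p]; last exact: pull_r.
  rewrite map_poly_comp => h0.
  have := etrans (esym (congr1 (fun p => (map_poly rho p).[rho Th.@[r]]) tsE)) h0.
  rewrite /= rmorph_prod horner_prod => /eqP.
  rewrite prodf_seq_eq0 => /hasP[t tts]; rewrite /= map_polyXsubC hornerXsubC subr_eq0 => /eqP tE.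
  by exists t; rewrite ?tE // tsE root_prod_XsubC.
have com_a : commr_rmorph (cone b) (cone a Th) by move=> p; apply: mulrC.
have com_b : commr_rmorph (iota \o meval y) (iota t) by move=> p; apply: mulrC.
have hbC (p : {mpoly V[d]}) : horner_morph com_b p%:P = iota p.@[y] by apply: horner_morphC.
have haC (p : {mpoly V[d]}) : horner_morph com_a p%:P = cone b p by apply: horner_morphC.
(* the specialization y_l |-> y l, theta |-> t of D[theta] *)
have [f /h_gen[g ->]|x|x|P' [io [al [be [alE beE le_ker sX]]]]] :=
  @lying_over {poly {mpoly V[d]}} {poly A} K (horner_morph com_a) (horner_morph com_b)
    [seq 'X * (a i)%:P | i : 'I_n].
- rewrite rmorphM [_ h](_ : _ = 0) ?mulr0 //.
  by rewrite /= /horner_morph map_poly_comp horner_map (rootP ht) rmorph0.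
- have [p [q [q0 qx]]] := vr_frac VR x; exists (p%:MP)%:P, (q%:MP)%:P.
  by rewrite /= !hbC !mevalC.
- move=> /mapP[i _ ->]; have [monF Fa] := FP i.
  exists (map_poly polyC (F i)); first exact: monic_map.
  apply/rootP; rewrite -map_poly_comp -[RHS](rootP Fa).
  by congr (_.[_]); apply: eq_map_poly => p; apply: haC.
have /choice[X XE] : forall i, exists p, al p = 'X * (a i)%:P.
  by move=> i; apply: sX; apply/mapP; exists i; rewrite ?mem_enum.
pose E (f : {mpoly V[n]}) : P' := mmap (io \o polyC \o @mpolyC d V) X f.
have alEf f : al (E f) = cone a f.
  rewrite /E mmap_rmorph; apply: eq_mmap => [c|i] /=; last exact: XE.
  by rewrite [LHS]alE /= haC mmapC.
have eval_al (p : {poly {mpoly V[d]}}) u :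
    al (map_poly (io \o polyC) p).[u] = (map_poly (cone b) p).[al u].
  rewrite -horner_map -map_poly_comp; congr (_.[_]); apply: eq_map_poly => q /=.
  by rewrite [LHS]alE /= haC.
have eval_be (p : {poly {mpoly V[d]}}) u :
    be (map_poly (io \o polyC) p).[u] = (map_poly iota (map_poly (meval y) p)).[be u].
  rewrite -horner_map -!map_poly_comp; congr (_.[_]); apply: eq_map_poly => q /=.
  by rewrite [LHS]beE /= hbC.
have /choice[c cP] : forall i, exists z, z \in L i /\ be (X i) = iota z.
  move=> i; have /le_ker : al (map_poly (io \o polyC) (F i)).[X i] = 0.
    by rewrite eval_al XE; apply/rootP; case: (FP i).
  rewrite eval_be LE rmorph_prod /= => /rootP.
  under eq_bigr do rewrite map_polyXsubC.
  rewrite -(big_map iota predT (fun z => 'X - z%:P)) root_prod_XsubC => /mapP[z zL zE].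
  by exists z.
have beEf f : be (E f) = iota f.@[c].
  rewrite /E mmap_rmorph /meval [RHS]mmap_rmorph; apply: eq_mmap => [e|i] /=.
    by rewrite [LHS]beE /= hbC mevalC.
  by case: (cP i).
exists c; split.
- apply: sP => [i|]; first by case: (cP i).
  rewrite -!Th_at -tE; congr (rho _); apply: (vr_iota_inj VR).
  have /le_ker : al (E Th - io 'X) = 0.
    by rewrite rmorphB alEf [al (io _)]alE /= horner_morphX subrr.
  by rewrite rmorphB beEf [be (io _)]beE /= horner_morphX => /eqP; rewrite subr_eq0 => /eqP.
- by move=> f fa; apply: (vr_inj VR); rewrite -beEf; apply: le_ker; rewrite alEf.
have /le_ker : al (map_poly (io \o polyC) FG).[E G] = 0.
  by rewrite eval_al alEf; apply/rootP.
rewrite eval_be beEf horner_map => /(vr_inj VR) FGc.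
apply: contra_neq FGy => Gc; move: FGc.
by rewrite Gc horner_coef0 coef_map.
Qed.

End Lifting.

From mathcomp Require Import finmap monalg mpoly.

(** * The valuation ring and the residue field *)

(** The valuation ring, its residue field and the coordinate ring of X come as
    commutative rings.  The structure of integral domain includes a boolean
    predicate for units and a total inverse function, chosen here classically. *)
Section ClassicalInverse.
Variable S : comNzRingType.

Definition classical_unit : {pred S} := fun x => `[< exists y, y * x = 1 >].

Definition classical_inv (x : S) : S :=
  if pselect (exists y, y * x = 1) is left e then projT1 (cid e) else x.

Lemma classical_mulVx : {in classical_unit, left_inverse 1 classical_inv *%R}.
Proof.
move=> x /asboolP ux; rewrite /classical_inv; case: pselect => // e.
by case: cid.
Qed.

Lemma classical_unitPl (x y : S) : y * x = 1 -> classical_unit x.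
Proof. by move=> yx; apply/asboolP; exists y. Qed.

Lemma classical_inv_out : {in [predC classical_unit], classical_inv =1 id}.
Proof.
by move=> x /asboolP nux; rewrite /classical_inv; case: pselect.
Qed.

End ClassicalInverse.

Section ValuationRingInstances.
Variables (K : fieldType) (R : realType) (nu : valuation K R).

HB.instance Definition _ := GRing.ComNzRing_hasMulInverse.Build (vring nu)
  (@classical_mulVx (vring nu)) (@classical_unitPl (vring nu)) (@classical_inv_out (vring nu)).

Fact vring_integral : GRing.integral_domain_axiom (vring nu).
Proof.
move=> a b /(congr1 val) ab; rewrite -!val_eqE /= -mulf_eq0.
exact/eqP.
Qed.
HB.instance Definition _ := GRing.ComUnitRing_isIntegral.Build (vring nu) vring_integral.

Lemma residue_lift (x : residue_field nu) : exists a, residue a = x.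
Proof. by exists (repr x); apply: reprK. Qed.

Lemma residue_neq0 (a : vring nu) : residue a != 0 -> val a != 0 /\ nu (val a) = 0.
Proof.
rewrite residue_eq0 !inE negb_or -leNgt => /andP[a0 le0].
split=> //; apply/eqP; rewrite eq_le le0.
by have := valP a; rewrite inE (negPf a0).
Qed.

Lemma vring_unit (a : vring nu) : residue a != 0 -> exists b, a * b = 1.
Proof.
move=> /residue_neq0[a0 nua].
have aV : (val a)^-1 \in vring_pred nu by rewrite inE vvalV // nua oppr0 lexx orbT.
by exists (VRing aV); apply: val_inj; rewrite /= divff.
Qed.

HB.instance Definition _ := GRing.ComNzRing_hasMulInverse.Build (residue_field nu)
  (@classical_mulVx (residue_field nu)) (@classical_unitPl (residue_field nu))
  (@classical_inv_out (residue_field nu)).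

Fact residue_field_axiom : GRing.field_axiom (residue_field nu).
Proof.
move=> x; have [a <-] := residue_lift x => /vring_unit[b ab].
apply/asboolP; exists (residue b).
by rewrite mulrC -rmorphM ab rmorph1.
Qed.
HB.instance Definition _ := GRing.ComUnitRing_isField.Build (residue_field nu) residue_field_axiom.

Fact vring_val_zmod : zmod_morphism (@vring_val K R nu). Proof. by []. Qed.
Fact vring_val_monoid : monoid_morphism (@vring_val K R nu). Proof. by []. Qed.
HB.instance Definition _ :=
  GRing.isZmodMorphism.Build (vring nu) K (@vring_val K R nu) vring_val_zmod.
HB.instance Definition _ :=
  GRing.isMonoidMorphism.Build (vring nu) K (@vring_val K R nu) vring_val_monoid.

Lemma vvalX (a : K) n : a != 0 -> nu (a ^+ n) = nu a *+ n.
Proof.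
move=> a0; elim: n => [|n IHn]; first by rewrite expr0 vval1.
by rewrite exprS vvalM ?expf_neq0 // IHn mulrS.
Qed.

Lemma vring_frac (x : K) : exists p q : vring nu, vring_val q != 0 /\ vring_val q * x = vring_val p.
Proof.
have [->|x0] := eqVneq x 0.
    by exists 0, 1; rewrite mulr0 rmorph0 rmorph1 oner_eq0.
  have [x_ge0|/ltW x_le0] := leP 0 (nu x).
    have xP : x \in vring_pred nu by rewrite inE x_ge0 orbT.
    by exists (VRing xP), 1; rewrite rmorph1 mul1r oner_eq0.
  have xP : x^-1 \in vring_pred nu by rewrite inE vvalV // oppr_ge0 x_le0 orbT.
  by exists 1, (VRing xP); rewrite rmorph1 /= mulVf // invr_eq0.
Qed.

Lemma vring_dvd (a b : vring nu) : val b != 0 ->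
  val a = 0 \/ nu (val b) <= nu (val a) -> exists z, a = z * b.
Proof.
move=> b0 ab.
have zP : val a / val b \in vring_pred nu.
  rewrite inE; case: ab => [->|le_ba]; first by rewrite mul0r eqxx.
  have [->|a0] := eqVneq (val a) 0; first by rewrite mul0r eqxx.
  by rewrite vvalM ?invr_eq0 // vvalV // subr_ge0 le_ba orbT.
by exists (VRing zP); apply: val_inj; rewrite /= divfK.
Qed.

(** The value group is a subgroup of the reals, hence archimedean. *)
Lemma vring_cic : completely_integrally_closed (vring nu).
Proof.
move=> c p q c0 q0 cp.
have nz (a : vring nu) : a != 0 -> val a != 0 by rewrite -val_eqE.
apply: vring_dvd; first exact: nz.
have [->|p0] := eqVneq p 0; [by left|right].
rewrite leNgt; apply/negP => lt_pq.
have d0 : 0 < nu (val q) - nu (val p) by rewrite subr_gt0.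
have [n] : exists n : nat, nu (val c) < (nu (val q) - nu (val p)) *+ n.
  exists (Num.bound (nu (val c) / (nu (val q) - nu (val p)))).
  rewrite -mulr_natl -ltr_pdivrMr //.
  apply/archi_boundP/divr_ge0; last exact: ltW.
  by have := valP c; rewrite inE (negPf (nz _ c0)).
have [z zE] := cp n.
have z0 : z != 0.
  apply: contraTneq isT => z0; have := mulf_neq0 c0 (expf_neq0 n p0).
  by rewrite zE z0 mul0r eqxx.
have zge0 : 0 <= nu (val z) by have := valP z; rewrite inE (negPf (nz _ z0)).
have valE (a b : vring nu) : a != 0 -> b != 0 ->
    nu (val (a * b ^+ n)) = nu (val a) + nu (val b) *+ n.
  move=> /nz a0 /nz b0; rewrite -vvalX // -vvalM ?expf_neq0 //.
  by rewrite -[val]/(@vring_val K R nu) rmorphM rmorphXn.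
have := congr1 (fun a => nu (val a)) zE; rewrite /= !valE // mulrnBl => sumE.
move: (nu (val c)) (nu (val z)) (nu (val p) *+ n) (nu (val q) *+ n) zge0 sumE => *.
by lra.
Qed.

Lemma vring_is_valuation_ring : nontrivial nu ->
  @is_valuation_ring (vring nu) K (residue_field nu) (@vring_val K R nu) (@residue K R nu).
Proof.
move=> [t t0 nut]; split.
- by move=> a a0; apply: val_inj.
- move=> a b; have [a0|a0] := eqVneq (val a) 0.
    by left; exists 0; apply: val_inj; rewrite mul0r.
  have [b0|b0] := eqVneq (val b) 0.
    by right; exists 0; apply: val_inj; rewrite mul0r.
  by have [le_ab|/ltW le_ba] := leP (nu (val a)) (nu (val b)); [right|left];
    apply: vring_dvd => //; right.
- exact: vring_frac.
- exact: vring_unit.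
- exact: residue_lift.
- exact: vring_cic.
have [s [s0 nus]] : exists s : K, s != 0 /\ 0 < nu s.
  have [lt0|gt0|/esym/eqP] := ltgtP (nu t) 0; last by rewrite eq_sym (negPf nut).
    by exists t^-1; rewrite invr_eq0 vvalV // oppr_gt0.
  by exists t.
have sP : s \in vring_pred nu by rewrite inE (ltW nus) orbT.
exists (VRing sP); first by rewrite -val_eqE.
by apply/eqP; rewrite residue_eq0 inE /= inE nus orbT.
Qed.

End ValuationRingInstances.

(** * Coordinate rings and lattices *)

Definition laurentC (K : fieldType) (M : zmodType) (a : K) : laurent K M := << a *g 0 >>.

Fact laurentC_zmod (K : fieldType) (M : zmodType) : zmod_morphism (@laurentC K M).
Proof. by move=> a b; rewrite /laurentC monalgUB. Qed.
Fact laurentC_monoid (K : fieldType) (M : zmodType) : monoid_morphism (@laurentC K M).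
Proof. by split=> [|a b]; rewrite /laurentC ?laurentUM ?addr0. Qed.
HB.instance Definition _ (K : fieldType) (M : zmodType) :=
  GRing.isZmodMorphism.Build K (laurent K M) (@laurentC K M) (@laurentC_zmod K M).
HB.instance Definition _ (K : fieldType) (M : zmodType) :=
  GRing.isMonoidMorphism.Build K (laurent K M) (@laurentC K M) (@laurentC_monoid K M).

Section CoordinateRing.
Local Open Scope quotient_scope.
Variables (K : fieldType) (M : zmodType).
Local Notation L := (laurent K M).
Variables (X : set (torus K M)) (irrX : irreducible X).

Definition vanishing_pred of irreducible X : {pred L} := fun f => `[< vanishing_ideal X f >].

Lemma vanishing_predP f : reflect (vanishing_ideal X f) (f \in vanishing_pred irrX).
Proof. exact: asboolP. Qed.

Fact vanishing_idealr_closed : idealr_closed (vanishing_pred irrX).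
Proof.
split.
- by apply/vanishing_predP => x _; rewrite rmorph0.
- have [[x Xx] _] := irrX; apply/vanishing_predP => /(_ x Xx)/eqP.
  by rewrite rmorph1 oner_eq0.
move=> a f g /vanishing_predP fX /vanishing_predP gX; apply/vanishing_predP => x Xx.
by rewrite rmorphD rmorphM /= (fX x Xx) (gX x Xx) mulr0 addr0.
Qed.
HB.instance Definition _ :=
  isIdealr.Build L (vanishing_pred irrX) vanishing_idealr_closed.

Definition coordinate_ring : Type := {ideal_quot (vanishing_pred irrX)}.
HB.instance Definition _ := GRing.ComNzRing.on coordinate_ring.

Definition restriction : L -> coordinate_ring := \pi_{ideal_quot (vanishing_pred irrX)}.
HB.instance Definition _ := GRing.RMorphism.on restriction.

Lemma restriction_eq0 f : restriction f = 0 <-> vanishing_ideal X f.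
Proof.
split=> [/eqP|/vanishing_predP f0]; last apply/eqP.
  by rewrite -(rmorph0 restriction) -Quotient.idealrBE subr0 => /vanishing_predP.
by rewrite -(rmorph0 restriction) -Quotient.idealrBE subr0.
Qed.

Lemma restriction_surj y : exists f, restriction f = y.
Proof. by exists (repr y); apply: reprK. Qed.

HB.instance Definition _ := GRing.ComNzRing_hasMulInverse.Build coordinate_ring
  (@classical_mulVx coordinate_ring) (@classical_unitPl coordinate_ring)
  (@classical_inv_out coordinate_ring).

(** The zero loci of f and g cover X if f g vanishes on X. *)
Fact coordinate_ring_integral : GRing.integral_domain_axiom coordinate_ring.
Proof.
move=> y z; have [f <-] := restriction_surj y; have [g <-] := restriction_surj z.
rewrite -rmorphM => /restriction_eq0 fg0.
have closed1 (h : L) : closed (zero_locus [set h]%classic).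
  by apply/closed_zariskiP; exists [set h]%classic.
have [_ /(_ _ _ (closed1 f) (closed1 g))] := irrX.
case=> [x Xx|fX|gX].
- have /eqP := fg0 x Xx; rewrite rmorphM mulf_eq0 => /orP[/eqP h0|/eqP h0]; [left|right];
  by move=> _ ->.
- by apply/orP; left; apply/eqP/restriction_eq0 => x Xx; apply: fX Xx _ _.
- by apply/orP; right; apply/eqP/restriction_eq0 => x Xx; apply: gX Xx _ _.
Qed.
HB.instance Definition _ :=
  GRing.ComUnitRing_isIntegral.Build coordinate_ring coordinate_ring_integral.

End CoordinateRing.

Section Lattice.
Variables (M : zmodType) (n : nat) (e : {additive M -> 'rV[int]_n}).
Hypothesis e_bij : bijective e.

Definition lattice_basis : 'I_n -> M := fun i => xget 0 [set u | e u = delta_mx 0 i]%classic.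

Lemma lattice_basisE i : e (lattice_basis i) = delta_mx 0 i.
Proof.
rewrite /lattice_basis; case: xgetP => [u _ /=//|]; have [g _ ge] := e_bij.
by move=> /(_ (g (delta_mx 0 i))) []; rewrite /= ge.
Qed.

(** The basis and its opposite generate M as a monoid. *)
Lemma lattice_ind (P : M -> Prop) :
  P 0 -> (forall u w, P u -> P w -> P (u + w)) ->
  (forall i, P (lattice_basis i)) -> (forall i, P (- lattice_basis i)) -> forall u, P u.
Proof.
move=> P0 PD PB PNB u.
have PX w m : P w -> P (w *+ m).
  by move=> Pw; elim: m => [|m IHm]; rewrite ?mulr0n ?mulrS //; apply: PD.
have -> : u = \sum_i lattice_basis i *~ e u 0 i.
  apply: (bij_inj e_bij); rewrite raddf_sum [LHS]row_sum_delta.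
  apply: eq_bigr => i _; rewrite raddfMz /= lattice_basisE.
  by rewrite -scaler_int intz.
elim/big_ind: _ => // i _; case: (e u 0 i) => m; first exact: PX.
by rewrite NegzE mulrNz -mulNrz; apply: PX.
Qed.

Variable K : fieldType.

Definition torus_coord (q : 'I_n -> K) (q0 : forall i, q i != 0) : torus K M.
Proof.
refine (@Torus K M (fun u => \prod_i q i ^ e u 0 i) _ _).
- by move=> u; apply/prodf_neq0 => i _; rewrite expfz_neq0.
- move=> u w; rewrite -big_split; apply: eq_bigr => i _ /=.
  by rewrite raddfD mxE expfzDr.
Defined.

Lemma torus_coord_basis q q0 i : @torus_coord q q0 (lattice_basis i) = q i.
Proof.
rewrite /= (bigD1 i) //= lattice_basisE mxE !eqxx expr1z big1 ?mulr1 // => i' ne.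
by rewrite mxE (negPf ne) andbF expr0z.
Qed.

End Lattice.

(** * Points with a prescribed tropical residue *)

Lemma evN (K : fieldType) (M : zmodType) (x : torus K M) u : x (- u) = (x u)^-1.
Proof. by apply: (mulfI (ev_neq0 x u)); rewrite -evD subrr ev0 divff ?ev_neq0. Qed.

Section TropicalResidue.
Variables (K : fieldType) (R : realType) (nu : valuation K R) (M : zmodType).
Local Notation L := (laurent K M).

Fact tiltedC_zmod (v : NG nu M) : zmod_morphism (tiltedC v).
Proof. by move=> a b; apply: val_inj; rewrite /= monalgUB. Qed.
Fact tiltedC_monoid (v : NG nu M) : monoid_morphism (tiltedC v).
Proof. by split=> [|a b]; apply: val_inj; rewrite /= ?laurentUM ?addr0. Qed.
HB.instance Definition _ v :=
  GRing.isZmodMorphism.Build (vring nu) (tilted v) (tiltedC v) (tiltedC_zmod v).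
HB.instance Definition _ v :=
  GRing.isMonoidMorphism.Build (vring nu) (tilted v) (tiltedC v) (tiltedC_monoid v).

(** R[M]^v is generated over the valuation ring by the monomials
    chi^u(x) x^u with v = trop x, and the point of T_v defined by x takes the
    value 1 on each of these. *)
Lemma tropical_residue_eq (x : torus K M) (p : Tv_k (trop nu x)) :
  (forall u (m : tilted (trop nu x)),
     tilted_val m = << x u *g u >> -> p (initial_form m) = 1) ->
  tropical_residue nu x = p.
Proof.
move=> pE; apply: Tv_k_ext => f; rewrite /= residue_funE.
have termP u : (<< x u *g u >> : L) \in tilted_pred (trop nu x).
  apply/tilted_predP => w; rewrite monalg.mcoeffU.
  by case: eqVneq => [<-|_]; rewrite ?mge0 // inE lexx orbT.
have coefP u : monalg.mcoeff u (f : L) / x u \in vring_pred nu.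
  have /tilted_predP/(_ u) fu := tilted_valP f.
  have xu : (x u)^-1 \in mge nu (- nu (x u)) by rewrite inE vvalV ?ev_neq0 // lexx orbT.
  by have := mgeM fu xu; rewrite subrr.
have -> : f = \sum_(u <- monalg.msupp (f : L)) tiltedC _ (VRing (coefP u)) * Tilted (termP u).
  apply: val_inj; rewrite /= raddf_sum [LHS]monalgE; apply: eq_bigr => u _.
  by rewrite [RHS]laurentUM add0r divfK ?ev_neq0.
rewrite !rmorph_sum; apply: eq_bigr => u _.
transitivity (residue (VRing (coefP u))); last first.
  by rewrite !rmorphM /= Tvk_const (pE u) // mulr1.
congr residue; apply: val_inj.
by rewrite /= rmorphM /= !levalU ev0 divr1 divff ?ev_neq0 // mulr1.
Qed.

End TropicalResidue.

Section UnitTerms.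
Variables (K : fieldType) (R : realType) (nu : valuation K R) (M : zmodType).
Local Notation L := (laurent K M).
Variables (v : NG nu M) (xbar : Tv_k v).

(** The points x in the fiber over [xbar] are those for which every
    chi^u(x) x^u is such a term ([exploded_trop_eq]). *)
Definition unit_term (u : M) (b : K) : Prop :=
  exists m : tilted v, tilted_val m = << b *g u >> /\ xbar (initial_form m) = 1.

Lemma unit_termP u b (m : tilted v) :
  tilted_val m = << b *g u >> -> unit_term u b -> xbar (initial_form m) = 1.
Proof.
by move=> mE [m' [m'E <-]]; congr (xbar (initial_form _)); apply: val_inj; rewrite /= mE m'E.
Qed.

Lemma unit_term0 : unit_term 0 1.
Proof. by exists 1; rewrite !rmorph1. Qed.

Lemma unit_termD u w b c : unit_term u b -> unit_term w c -> unit_term (u + w) (b * c).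
Proof.
move=> [m [mE m1]] [m' [m'E m'1]]; exists (m * m').
by rewrite !rmorphM /= mE m'E laurentUM m1 m'1 mulr1.
Qed.

Lemma tilted_term u b : v u <= nu b -> (<< b *g u >> : L) \in tilted_pred v.
Proof.
move=> le_ub; apply/tilted_predP => w; rewrite monalg.mcoeffU.
by case: eqVneq => [<-|_]; rewrite ?mge0 // inE le_ub orbT.
Qed.

(** A coefficient of valuation larger than <u, v> would make the initial form
    vanish, contrary to its value 1. *)
Lemma unit_term_val u b : unit_term u b -> b != 0 /\ nu b = v u.
Proof.
move=> [m [mE m1]].
have m_neq0 : initial_form m != 0.
  by apply: contra_eq_neq m1 => ->; rewrite rmorph0 eq_sym oner_eq0.
have b0 : b != 0.
  apply: contra_neq m_neq0 => b0; rewrite -(rmorph0 (@initial_form _ _ _ _ v)); congr initial_form.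
  by apply: val_inj; rewrite /= mE b0 monalgU0.
split=> //; apply/eqP; rewrite eq_le.
have /tilted_predP/(_ u) := tilted_valP m; rewrite mE monalg.mcoeffUU inE (negPf b0) /= => ->.
rewrite andbT leNgt; apply: contra m_neq0 => lt_ub.
rewrite initial_form_eq0; apply/tilted_plusP => w; rewrite mE monalg.mcoeffU.
by case: eqVneq => [<-|_]; rewrite ?mgt0 // inE lt_ub orbT.
Qed.

Lemma pairingN u : v (- u) = - v u.
Proof. by apply/eqP; rewrite -addr_eq0 -pairingD addNr pairing0. Qed.

Lemma unit_termN u b : unit_term u b -> unit_term (- u) b^-1.
Proof.
move=> ub; have [b0 nub] := unit_term_val ub; have [m [mE m1]] := ub.
have bP : (<< b^-1 *g - u >> : L) \in tilted_pred v.
  by apply: tilted_term; rewrite pairingN vvalV // nub.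
exists (Tilted bP); split=> //.
have mb : m * Tilted bP = 1.
  by apply: val_inj; rewrite rmorphM /= mE laurentUM divff // subrr.
have := congr1 (fun f => xbar (initial_form f)) mb.
by rewrite /= !rmorphM /= m1 mul1r !rmorph1.
Qed.

Lemma unit_termZ u b (a : vring nu) : residue a = 1 -> unit_term u b -> unit_term u (val a * b).
Proof.
move=> a1 [m [mE m1]]; exists (tiltedC v a * m).
by rewrite !rmorphM /= mE laurentUM add0r m1 mulr1 Tvk_const a1.
Qed.

(** The initial form of b x^u with nu(b) = <u, v> is invertible, so [xbar] takes
    a nonzero value on it; b is corrected by a lift of the inverse value. *)
Lemma unit_term_exists u : exists b, unit_term u b.
Proof.
have [b b0 bv] := pairingG v u.
have bP : (<< b *g u >> : L) \in tilted_pred v by apply: tilted_term; rewrite bv.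
have b'P : (<< b^-1 *g - u >> : L) \in tilted_pred v.
  by apply: tilted_term; rewrite pairingN vvalV // bv.
have bb' : Tilted bP * Tilted b'P = 1.
  by apply: val_inj; rewrite rmorphM /= laurentUM divff // subrr.
have [a aE] := residue_lift (xbar (initial_form (Tilted b'P))).
exists (val a * b), (tiltedC v a * Tilted bP).
rewrite !rmorphM /= laurentUM add0r Tvk_const aE; split=> //; rewrite mulrC.
have := congr1 (fun f => xbar (initial_form f)) bb'.
by rewrite /= !rmorphM /= => ->; rewrite !rmorph1.
Qed.

Lemma exploded_trop_eq (x : torus K M) :
  (forall u, unit_term u (x u)) -> exploded_trop nu x = existT _ v xbar.
Proof.
move=> xu; have vE : v = trop nu x by apply: NG_ext => u; case: (unit_term_val (xu u)).
have xbarE u (m : tilted v) : tilted_val m = << x u *g u >> -> xbar (initial_form m) = 1.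
  by move=> mE; apply: unit_termP mE _.
suff eqT w (p : Tv_k w) : w = trop nu x ->
    (forall u (m : tilted w), tilted_val m = << x u *g u >> -> p (initial_form m) = 1) ->
    exploded_trop nu x = existT _ w p by apply: eqT.
move=> wE; move: p; rewrite wE => p /tropical_residue_eq <-.
by [].
Qed.

(** Substituting the unit terms b_i x^(u_i) in f gives an element of R[M]^v, on
    whose initial form [xbar] takes the value f(1, ..., 1). *)
Lemma residue_relation (X : set (torus K M)) n (u : 'I_n -> M) (b : 'I_n -> K) :
  tropical_reduction X xbar -> (forall i, unit_term (u i) (b i)) ->
  forall f : mpoly n (vring nu),
  vanishing_ideal X (mmap (@laurentC K M \o @vring_val K R nu) (fun i => << b i *g u i >> : L) f) ->
  residue f.@[fun=> 1] = 0.
Proof.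
move=> xbarX /choice[m mE] f fX.
pose ft : tilted v := mmap (tiltedC v) m f.
have ftE : tilted_val ft =
    mmap (@laurentC K M \o @vring_val K R nu) (fun i => << b i *g u i >> : L) f.
  by rewrite /ft mmap_rmorph; apply: eq_mmap => // i /=; case: (mE i).
have := xbarX ft; rewrite ftE => /(_ fX) <-.
rewrite /ft /meval !mmap_rmorph; apply: eq_mmap => [a|i] /=; first by rewrite Tvk_const.
by case: (mE i) => _ ->; rewrite rmorph1.
Qed.

End UnitTerms.

(** * Laurent polynomials as fractions on the cone *)

(** Each element f of L is to be a quotient Y / Y0 of polynomials in the
    coordinates of the cone over A, compatibly with a family [over] of points c
    of the cone and of the homomorphisms psi from L to K that they define.  Then
    the vanishing or not of f under psi can be read off from Y at c. *)
Section ConeFractions.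
Variables (V : idomainType) (K : fieldType) (iota : {rmorphism V -> K}).
Variables (L : comNzRingType) (A : idomainType) (res : {rmorphism L -> A}).
Variables (j : {rmorphism V -> A}) (n : nat) (a : 'I_n -> A).
Variable over : ('I_n -> V) -> {rmorphism L -> K} -> Prop.

Local Notation cone := (mmap (polyC \o j) (fun i => 'X * (a i)%:P)).

Definition cone_fraction (f : L) : Prop := exists Y Y0 : mpoly n V,
  [/\ cone Y = (res f)%:P * cone Y0, cone Y0 != 0 &
      forall c psi, over c psi ->
        iota Y.@[c] = psi f * iota Y0.@[c] /\ iota Y0.@[c] != 0].

Lemma cone_fractionD f g : cone_fraction f -> cone_fraction g -> cone_fraction (f + g).
Proof.
move=> [Y [Y0 [YE Y00 Yp]]] [Z [Z0 [ZE Z00 Zp]]].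
exists (Y * Z0 + Z * Y0), (Y0 * Z0); split.
- by rewrite !rmorphD !rmorphM /= YE ZE; ring.
- by rewrite rmorphM mulf_neq0.
move=> c p cp; have [Yc Y0c] := Yp c p cp; have [Zc Z0c] := Zp c p cp.
rewrite !(rmorphD, rmorphM) /= Yc Zc; split; last exact: mulf_neq0.
by ring.
Qed.

Lemma cone_fractionM f g : cone_fraction f -> cone_fraction g -> cone_fraction (f * g).
Proof.
move=> [Y [Y0 [YE Y00 Yp]]] [Z [Z0 [ZE Z00 Zp]]].
exists (Y * Z), (Y0 * Z0); split.
- by rewrite !rmorphM /= YE ZE; ring.
- by rewrite rmorphM mulf_neq0.
move=> c p cp; have [Yc Y0c] := Yp c p cp; have [Zc Z0c] := Zp c p cp.
by rewrite !rmorphM /= Yc Zc; split; [ring|apply: mulf_neq0].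
Qed.

Lemma cone_fraction_scalar f p q :
  res f * j q = j p -> j q != 0 ->
  (forall c psi, over c psi -> psi f * iota q = iota p /\ iota q != 0) ->
  cone_fraction f.
Proof.
move=> fE q0 cP; exists p%:MP, q%:MP; split.
- by rewrite !mmapC /= -fE polyCM.
- by rewrite mmapC /= polyC_eq0.
by move=> c psi /cP[fq ?]; rewrite !mevalC fq.
Qed.

Lemma cone_fraction_coord f i i0 :
  res f * a i0 = a i -> a i0 != 0 ->
  (forall c psi, over c psi -> psi f * iota (c i0) = iota (c i) /\ iota (c i0) != 0) ->
  cone_fraction f.
Proof.
move=> fE a0 cP; exists 'X_i, 'X_i0; split.
- by rewrite !mmapX !mmap1U -fE polyCM mulrCA.
- by rewrite mmapX mmap1U mulf_neq0 ?polyX_eq0 // polyC_eq0.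
by move=> c psi /cP[fq ?]; rewrite !mevalXU fq.
Qed.

Lemma cone_fraction_vanish f c psi : cone_fraction f -> over c psi ->
  (forall Y, cone Y = 0 -> Y.@[c] = 0) -> res f = 0 -> psi f = 0.
Proof.
move=> [Y [Y0 [YE _ Yp]]] /Yp[Yc Y0c] cX f0; move: Yc.
rewrite cX ?rmorph0 => [/esym/eqP|]; last by rewrite YE f0 mul0r.
by rewrite mulf_eq0 (negPf Y0c) orbF => /eqP.
Qed.

(** Setting Z = 1 maps the cone over A to A. *)
Lemma cone_specialize f : cone f = 0 -> mmap j a f = 0.
Proof.
move=> /(congr1 (horner_eval 1)); rewrite mmap_rmorph rmorph0 => <-.
apply: eq_mmap => [b|i] /=; rewrite /horner_eval ?hornerC //.
by rewrite hornerM hornerX hornerC mul1r.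
Qed.

End ConeFractions.

Section LaurentFractions.
Variables (K : fieldType) (R : realType) (nu : valuation K R) (M : zmodType).
Variables (X : set (torus K M)) (irrX : irreducible X).
Variables (n : nat) (e : {additive M -> 'rV[int]_n}).
Hypothesis e_bij : bijective e.
Variables (t : 'I_n -> K).
Hypothesis t_neq0 : forall i, t i != 0.
Local Notation L := (laurent K M).

(** The index 0 is the coordinate of the cone, with exponent 0 and scale 1. *)
Definition cone_exponent (i : 'I_n.+1) : M :=
  if unlift ord0 i is Some i' then lattice_basis e i' else 0.
Definition cone_scale (i : 'I_n.+1) : K := if unlift ord0 i is Some i' then t i' else 1.

Definition vring_scalar : vring nu -> coordinate_ring irrX :=
  restriction irrX \o @laurentC K M \o @vring_val K R nu.
HB.instance Definition _ := GRing.RMorphism.on vring_scalar.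

Definition cone_coord (i : 'I_n.+1) : coordinate_ring irrX :=
  restriction irrX << cone_scale i *g cone_exponent i >>.

(** Here c = (c_0, ..., c_n) are homogeneous coordinates of p in terms of the
    scaled monomials, which take the values c_i / c_0 at p. *)
Definition over_cone (c : 'I_n.+1 -> vring nu) (psi : {rmorphism L -> K}) :=
  exists2 p : torus K M, psi = leval p :> (L -> K) &
  (forall i, vring_val (c i) != 0) /\
  forall i, cone_scale i / p (cone_exponent i) * vring_val (c ord0) = vring_val (c i).

Lemma vring_scalar_inj a : vring_scalar a = 0 -> a = 0.
Proof.
have [[x Xx] _] := irrX.
by move=> /restriction_eq0/(_ x Xx); rewrite levalU ev0 divr1 => a0; apply: val_inj.
Qed.

Lemma cone_scale_neq0 i : cone_scale i != 0.
Proof. by rewrite /cone_scale; case: unlift => // *; apply: oner_neq0. Qed.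

Lemma cone_coordV i :
  restriction irrX << (cone_scale i)^-1 *g - cone_exponent i >> * cone_coord i = 1.
Proof.
by rewrite -rmorphM laurentUM mulVf ?cone_scale_neq0 // addNr -laurent1E rmorph1.
Qed.

Lemma cone_coord_neq0 i : cone_coord i != 0.
Proof.
apply: contra_eq_neq (cone_coordV i) => ->.
by rewrite mulr0 eq_sym oner_eq0.
Qed.

Lemma cone_coord0 : cone_coord ord0 = 1.
Proof. by rewrite /cone_coord /cone_scale /cone_exponent unlift_none -laurent1E rmorph1. Qed.

Local Notation fraction :=
  (@cone_fraction (vring nu) K (@vring_val K R nu) L (coordinate_ring irrX) (restriction irrX)
    vring_scalar n.+1 cone_coord over_cone).

(** Fractions are closed under sums and products and contain the constants and
    the scaled basis monomials with their inverses, hence all monomials. *)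
Lemma laurent_fraction f : fraction f.
Proof.
have fractionC a : fraction (laurentC M a).
  have [p [q [q0 qa]]] := vring_frac nu a.
  apply: (@cone_fraction_scalar _ _ _ _ _ _ _ _ _ _ _ p q).
  - by rewrite /vring_scalar /= -rmorphM; congr restriction; rewrite -rmorphM -qa mulrC.
  - apply: contra_neq q0 => /vring_scalar_inj ->; exact: rmorph0.
  by move=> c psi [x -> _]; rewrite levalU ev0 divr1 mulrC.
have liftE i : cone_exponent (lift ord0 i) = lattice_basis e i.
  by rewrite /cone_exponent liftK.
have mono u : exists2 b, b != 0 & fraction << b *g u >>.
  elim/(lattice_ind e_bij): u => [|u w [b b0 fb] [b' b'0 fb']|i|i].
  - exists 1; rewrite ?oner_eq0 // -laurent1E -(rmorph1 (@laurentC K M)); exact: fractionC.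
  - by exists (b * b'); [exact: mulf_neq0|rewrite -laurentUM; exact: cone_fractionM].
  - exists (cone_scale (lift ord0 i)); first exact: cone_scale_neq0.
    rewrite -liftE; apply: (@cone_fraction_coord _ _ _ _ _ _ _ _ _ _ _ (lift ord0 i) ord0).
    + by rewrite cone_coord0 mulr1.
    + exact: cone_coord_neq0.
    by move=> c psi [x -> [c0 cE]]; rewrite levalU; split; [apply: cE|apply: c0].
  - exists (cone_scale (lift ord0 i))^-1; first by rewrite invr_eq0 cone_scale_neq0.
    rewrite -liftE; apply: (@cone_fraction_coord _ _ _ _ _ _ _ _ _ _ _ ord0 (lift ord0 i)).
    + by rewrite cone_coordV cone_coord0.
    + exact: cone_coord_neq0.
    move=> c psi [x -> [c0 cE]]; rewrite levalU evN invrK; split; last exact: c0.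
    rewrite /= -(cE (lift ord0 i)) mulrA.
    by rewrite mulrACA mulVf ?cone_scale_neq0 // divff ?ev_neq0 // mulr1 mul1r.
rewrite [f]monalgE; elim/big_ind: _ => [|g h|u _].
- by rewrite -(rmorph0 (@laurentC K M)); apply: fractionC.
- exact: cone_fractionD.
have [b b0 fb] := mono u.
have -> : << monalg.mcoeff u f *g u >> = laurentC M (monalg.mcoeff u f / b) * << b *g u >> :> L.
  by rewrite laurentUM add0r divfK.
exact: cone_fractionM.
Qed.

End LaurentFractions.

(** * Density of the fibers *)

Local Open Scope classical_set_scope.

Theorem theorem4p1 (K : closedFieldType) (R : realType) (nu : valuation K R)
    (nu_nontrivial : nontrivial nu)
    (M : zmodType) (M_lattice : is_lattice M)
    (X : set (torus K M)) (X_subvariety : subvariety X)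
    (v : NG nu M) (xbar : Tv_k v) (xbar_Xv : tropical_reduction X xbar) :
  X `<=` closure (@exploded_trop K R nu M @^-1` [set existT _ v xbar] `&` X).
Proof.
have [n [e e_bij]] := M_lattice; have [closedX irrX] := X_subvariety.
have VR := vring_is_valuation_ring nu_nontrivial.
move=> x0 Xx0 U; rewrite nbhsE => -[W [openW Wx0] WU].
have /zariski_openP[S WS] : zariski_open W := openW.
have /WS[g Sg gx0] := Wx0.
have /choice[t tP] := fun i => unit_term_exists xbar (lattice_basis e i).
have t0 i : t i != 0 by case: (unit_term_val (tP i)).
have fraction := laurent_fraction nu irrX e_bij t0.
have [Y [Y0 [YE Y00 Yp]]] := fraction g.
have gen i : unit_term xbar (cone_exponent e i) (cone_scale t i).
  by rewrite /cone_exponent /cone_scale; case: unlift => [i'|]; [exact: tP|exact: unit_term0].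
have [f f0||c [c1 cX cY]] := lift_residue_point VR (@vring_scalar_inj _ _ nu _ _ irrX)
  (a := cone_coord irrX e t) (r := fun=> 1) (G := Y).
- apply: (residue_relation xbar_Xv gen); apply/(restriction_eq0 irrX).
  by rewrite mmap_rmorph; apply: cone_specialize f0.
- rewrite YE mulf_neq0 // polyC_eq0; apply/eqP => /restriction_eq0/(_ x0 Xx0)/eqP.
  by rewrite (negPf gx0).
have c_unit i : exists d, [/\ c i * d = 1, residue d = 1 & vring_val (c i) != 0].
  have ci : residue (c i) = 1 by rewrite c1 rmorph1.
  have ci0 : residue (c i) != 0 by rewrite ci oner_eq0.
  have [d cd] := vring_unit ci0; exists d; split=> //; last by case: (residue_neq0 ci0).
  by rewrite -[LHS]mul1r -{1}ci -rmorphM cd rmorph1.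
have c0 i : vring_val (c i) != 0 by case: (c_unit i) => d [].
(* the point of T at which t_i x^(B_i) takes the value c_(i+1) / c_0 *)
pose q i := t i * vring_val (c ord0) / vring_val (c (lift ord0 i)).
have q0 i : q i != 0 by rewrite !mulf_neq0 ?invr_eq0.
pose p := torus_coord e q0.
have pE i : p (lattice_basis e i) = q i by apply: torus_coord_basis.
have cp : over_cone e t c (leval p).
  exists p => //; split=> // i; rewrite /cone_scale /cone_exponent.
  case: unliftP => [i' ->|->]; last by rewrite ev0 divr1 mul1r.
  by rewrite pE /q; field; rewrite !c0 t0.
have basis_unit i : unit_term xbar (lattice_basis e i) (p (lattice_basis e i)).
  have [d [cd d1 _]] := c_unit (lift ord0 i).
  have -> : p (lattice_basis e i) = vring_val (c ord0 * d) * t i.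
    rewrite pE /q; have dE : vring_val d = (vring_val (c (lift ord0 i)))^-1.
      by apply: (mulfI (c0 (lift ord0 i))); rewrite divff //; apply: (congr1 val cd).
    by rewrite rmorphM /= dE; ring.
  by apply: unit_termZ (tP i); rewrite rmorphM /= d1 c1 rmorph1 mulr1.
exists p; split; last first.
  apply/WU/WS; exists g => //; have [Yc _] := Yp c _ cp.
  by apply: contra_neq cY => gp; apply: val_inj; rewrite /= Yc /= gp mul0r.
split.
  apply: exploded_trop_eq; elim/(lattice_ind e_bij) => [|u w|i|i].
  - by rewrite ev0; apply: unit_term0.
  - by rewrite evD; apply: unit_termD.
  - exact: basis_unit.
  - by rewrite evN; apply/unit_termN/basis_unit.
have [S' XE] : exists S, X = zero_locus S by apply/closed_zariskiP.
rewrite XE => f S'f; apply: (cone_fraction_vanish (fraction f) cp cX).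
by apply/restriction_eq0 => x; rewrite XE => /(_ f S'f).
Qed.
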